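(* For any $w, w' \in \widehat{\mathfrak{H}^{0}}$ it holds that \[ Z_{\omega}(w \mathbin{\sqcup\!\!\sqcup}_{\hbar} w') = Z_{\omega}(w)\, Z_{\omega}(w'). \]
   Context: Let $\hbar$ be a formal variable, $\mathcal{C}=\mathbb{Q}[\hbar]$ and $\mathfrak{H}=\mathcal{C}\langle a,b\rangle$ the non-commutative polynomial ring in $a,b$. For $k\ge 1$ put $g_k=ba^k$ and $e_k=b(a+\hbar)a^{k-1}$; thus $e_1-g_1=\hbar b$. Let $\mathcal{A}=\{\hbar b\}\cup\{ba^k\mid k\ge 1\}$. Let $\mathcal{M}$ be the set consisting of $1$ and all monomials (words) in the letters of $\mathcal{A}$, and $\mathcal{M}_0\subset\mathcal{M}$ the subset of those whose rightmost letter is not $e_1-g_1$ (including $1$); equivalently $\mathcal{M}_0$ consists of the elements $(e_1-g_1)^{\alpha_1}g_{\beta_1+1}\cdots(e_1-g_1)^{\alpha_r}g_{\beta_r+1}$ with $r\ge0$, $\alpha_j,\beta_j\ge 0$. Let $\widehat{\mathfrak{H}^{0}}$ be the $\mathcal{C}$-submodule of $\mathfrak H$ spanned by $\mathcal{M}_0$. The shuffle product $\mathbin{\sqcup\!\!\sqcup}_\hbar$ is the $\mathcal{C}$-bilinear operation on $\mathfrak{H}$ uniquely determined by: $w\mathbin{\sqcup\!\!\sqcup}_\hbar 1=1\mathbin{\sqcup\!\!\sqcup}_\hbar w=w$; $wa\mathbin{\sqcup\!\!\sqcup}_\hbar w'a=(wa\mathbin{\sqcup\!\!\sqcup}_\hbar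 w'+w\mathbin{\sqcup\!\!\sqcup}_\hbar w'a+\hbar\, w\mathbin{\sqcup\!\!\sqcup}_\hbar w')a$; $wb\mathbin{\sqcup\!\!\sqcup}_\hbar w'=w\mathbin{\sqcup\!\!\sqcup}_\hbar w'b=(w\mathbin{\sqcup\!\!\sqcup}_\hbar w')b$ for $w,w'\in\mathfrak H$. (The module $\widehat{\mathfrak{H}^{0}}$ is closed under it.) Fix $0<\omega<2$ and regard $\mathbb{C}$ (and functions into $\mathbb C$) as $\mathcal{C}$-modules on which $\hbar$ acts as multiplication by $2\pi i\omega$. Let $\mathfrak z$ be the $\mathcal C$-span of $\mathcal A$ and define the $\mathcal{C}$-linear map $v\mapsto I_\omega(v\,|\,t)$ from $\mathfrak z$ to meromorphic functions of $t\in\mathbb C$ by $I_\omega(e_1-g_1\,|\,t)=2\pi i\omega$ and $I_\omega(g_k\,|\,t)=\left(\frac{2\pi i\omega}{e^{-2\pi i\omega t}-1}\right)^k$ for $k\ge1$. Define the $\mathcal{C}$-linear map $Z_\omega:\widehat{\mathfrak{H}^{0}}\to\mathbb{C}$ by $Z_\omega(1)=1$ and, for $u_1,\dots,u_r\in\mathcal A$ with $u_r\neq e_1-g_1$, \[ Z_\omega(u_1\cdots u_r)=\prod_{a=1}^r\int_{-\epsilon+i\mathbb R}\frac{dt_a}{e^{2\pi i t_a}-1}\prod_{a=1}^r I_\omega(u_a\,|\,t_1+\cdots+t_a), \] where $0<\epsilon<\min(1,1/(r\omega))$; this integral converges absolutely and does not depend on $\epsilon$. *)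

(* Defs.v *)
From HB Require Import structures.
From mathcomp Require Import all_boot all_order all_algebra.
From mathcomp Require Import finmap.
From mathcomp Require Import all_classical all_reals all_analysis.
From mathcomp Require Import complex.
(* The notations of monalg clash with those of mathcomp-analysis. *)
From mathcomp Require Import -(notations) monalg.

Set Implicit Arguments.
Unset Strict Implicit.
Unset Printing Implicit Defensive.

Import Order.TTheory GRing.Theory Num.Theory.
Local Open Scope ring_scope.

Definition hbar : {poly rat} := 'X.

(* Q[hbar]<a, b>: the monoid algebra of the free monoid on two letters, the
   letter a being encoded by false and the letter b by true. *)
Definition frakH := malg (fmonom bool) {poly rat}.
HB.instance Definition _ := GRing.Lalgebra.on frakH.

Lemma malg_scalerAr (c : {poly rat}) (x y : frakH) : c *: (x * y) = x * (c *: y).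
Proof.
apply/malgP => k; rewrite mcoeffZ (mcoeffMlw _ (fsubset_refl _) (fsubset_refl _)).
rewrite (mcoeffMlw _ (fsubset_refl _) (msuppZ_le c y)) mulr_sumr.
apply: eq_bigr => i _; rewrite mulr_sumr; apply: eq_bigr => j _.
by rewrite mcoeffZ mulrnAr [c * (_ * _)]mulrCA.
Qed.

HB.instance Definition _ :=
  GRing.Lalgebra_isAlgebra.Build {poly rat} frakH malg_scalerAr.

Definition word (s : seq bool) : frakH := mkmalgU (FMonom s) 1.
Definition ga : frakH := word [:: false].
Definition gb : frakH := word [:: true].

Definition gk (k : nat) : frakH := gb * ga ^+ k.
Definition ek (k : nat) : frakH := gb * (ga + hbar%:A) * ga ^+ k.-1.

(* The alphabet {e_1 - g_1} U {g_k | k >= 1} is indexed by nat: the code 0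
   stands for e_1 - g_1 (and NOT for gk 0), the code k >= 1 for g_k. *)
Definition Aletter (k : nat) : frakH := if k is 0 then ek 1 - gk 1 else gk k.

Lemma e1_sub_g1 : ek 1 - gk 1 = hbar *: gb.
Proof.
by rewrite /ek /gk expr0 mulr1 expr1 -mulrBr addrC addKr -scalerAr mulr1.
Qed.

Definition monomial (s : seq nat) : frakH := \prod_(k <- s) Aletter k.

Definition admissible (s : seq nat) : bool := last 1%N s != 0%N.

Definition H0hat (f : frakH) : Prop :=
  exists cs : seq ({poly rat} * seq nat),
    all (fun p => admissible p.2) cs /\
    f = \sum_(p <- cs) p.1 *: monomial p.2.

(* Shuffle product of two words given by their REVERSED letter sequences, so
   that the recursion acts on the rightmost letters. *)
Fixpoint shuffle_rev (u : seq bool) : seq bool -> frakH :=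
  match u with
  | [::] => fun v => word (rev v)
  | x :: u' => fix aux (v : seq bool) : frakH :=
      match v with
      | [::] => word (rev u)
      | y :: v' =>
          if x then shuffle_rev u' v * gb
          else if y then aux v' * gb
          else (aux v' + shuffle_rev u' v + hbar *: shuffle_rev u' v') * ga
      end
  end.

Definition shuffle (f h : frakH) : frakH :=
  \sum_(u <- msupp f) \sum_(v <- msupp h)
    (mcoeff u f * mcoeff v h) *:
      shuffle_rev (rev (fmonom_val u)) (rev (fmonom_val v)).

Lemma word_cat s t : word s * word t = word (s ++ t).
Proof. by rewrite /word malgM_def /= fgmulUU mulr1 /mul /= /fmmul fmE. Qed.

Lemma word_nil : word [::] = 1.
Proof. by rewrite /word /GRing.one /= /fgone /one /= /fmone fmE. Qed.

Lemma H_ind (P : frakH -> Prop) : P 0 ->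
  (forall c s f, P f -> P (c *: word s + f)) -> forall f, P f.
Proof.
move=> P0 PS f; rewrite [f]monalgE.
elim: (enum_fset (msupp f)) => [|[s] r IH]; first by rewrite big_nil.
rewrite big_cons; have -> : mkmalgU (FMonom s) (mcoeff (FMonom s) f) =
    mcoeff (FMonom s) f *: word s.
  by apply/malgP => k; rewrite mcoeffZ !mcoeffU mulr_natr.
exact: PS.
Qed.

Lemma sum_msuppw (V : zmodType) (F : fmonom bool -> {poly rat} -> V) (f : frakH)
    (d : {fset fmonom bool}) :
    (forall k, F k 0 = 0) -> fsubset (msupp f) d ->
  \sum_(k <- msupp f) F k (mcoeff k f) = \sum_(k <- d) F k (mcoeff k f).
Proof.
move=> F0 le; apply: big_fset_incl => //= k _ kN.
by rewrite mcoeff_outdom.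
Qed.

Lemma sum_msupp_lin (V : zmodType) (F : fmonom bool -> {poly rat} -> V)
    (c : {poly rat}) (f1 f2 : frakH) : (forall k x y, F k (x + y) = F k x + F k y) ->
  \sum_(k <- msupp (c *: f1 + f2)) F k (mcoeff k (c *: f1 + f2)) =
  \sum_(k <- msupp f1) F k (c * mcoeff k f1) +
  \sum_(k <- msupp f2) F k (mcoeff k f2).
Proof.
move=> FD; have F0 k : F k 0 = 0.
  by apply: (addIr (F k 0)); rewrite -FD !add0r.
have le1 : fsubset (msupp (c *: f1 + f2)) (fsetU (msupp f1) (msupp f2)).
  apply: (fsubset_trans (msuppD_le _ _)); apply: fsetUSS => //.
  exact: msuppZ_le.
rewrite (sum_msuppw F0 le1).
rewrite (@sum_msuppw _ (fun k x => F k (c * x)) f1 _ _ (fsubsetUl _ (msupp f2)))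
  => [|k]; last by rewrite mulr0.
rewrite (sum_msuppw F0 (fsubsetUr (msupp f1) (msupp f2))).
by rewrite -big_split; apply: eq_bigr => k _; rewrite mcoeffD mcoeffZ FD.
Qed.

Lemma sum_msupp_word (V : zmodType) (F : fmonom bool -> {poly rat} -> V) s :
  \sum_(k <- msupp (word s)) F k (mcoeff k (word s)) = F (FMonom s) 1.
Proof. by rewrite msuppU1 big_seq_fset1 mcoeffUU. Qed.

(* The following lemmas are the characterization of the shuffle product by
   bilinearity and recursion on the rightmost letters. *)
Lemma shuffle_linearl c f1 f2 h :
  shuffle (c *: f1 + f2) h = c *: shuffle f1 h + shuffle f2 h.
Proof.
rewrite /shuffle (@sum_msupp_lin _ (fun u x => \sum_(v <- msupp h)
   (x * mcoeff v h) *: shuffle_rev (rev (fmonom_val u)) (rev (fmonom_val v)))).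
  rewrite scaler_sumr; congr (_ + _); apply: eq_bigr => u _.
  by rewrite scaler_sumr; apply: eq_bigr => v _; rewrite scalerA mulrA.
by move=> u x y; rewrite -big_split; apply: eq_bigr => v _; rewrite mulrDl scalerDl.
Qed.

Lemma shuffle_linearr c f h1 h2 :
  shuffle f (c *: h1 + h2) = c *: shuffle f h1 + shuffle f h2.
Proof.
rewrite /shuffle scaler_sumr -big_split; apply: eq_bigr => u _ /=.
rewrite (@sum_msupp_lin _ (fun v x =>
   (mcoeff u f * x) *: shuffle_rev (rev (fmonom_val u)) (rev (fmonom_val v)))).
  congr (_ + _); rewrite [RHS]scaler_sumr; apply: eq_bigr => v _.
  by rewrite scalerA; congr (_ *: _); exact: mulrCA.
by move=> v x y; rewrite mulrDr scalerDl.
Qed.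

Lemma shuffle_word s t : shuffle (word s) (word t) = shuffle_rev (rev s) (rev t).
Proof.
rewrite /shuffle (@sum_msupp_word _ (fun u x => \sum_(v <- msupp (word t))
  (x * mcoeff v (word t)) *:
     shuffle_rev (rev (fmonom_val u)) (rev (fmonom_val v)))).
rewrite (@sum_msupp_word _ (fun v x =>
  (1 * x) *: shuffle_rev (rev s) (rev (fmonom_val v)))).
by rewrite mulr1 scale1r.
Qed.

Lemma mulH_linearl (c : {poly rat}) (x y z : frakH) :
  (c *: x + y) * z = c *: (x * z) + y * z.
Proof. by rewrite mulrDl scalerAl. Qed.

Lemma shuffle0l h : shuffle 0 h = 0.
Proof. by rewrite /shuffle msupp0 big_seq_fset0. Qed.

Lemma shuffle0r f : shuffle f 0 = 0.
Proof. by rewrite /shuffle big1 // => u _; rewrite msupp0 big_seq_fset0. Qed.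

Lemma shuffle1l h : shuffle 1 h = h.
Proof.
elim/H_ind: h => [|c s h IH]; first exact: shuffle0r.
by rewrite shuffle_linearr IH -word_nil shuffle_word /= revK.
Qed.

Lemma shuffle1r f : shuffle f 1 = f.
Proof.
elim/H_ind: f => [|c s f IH]; first exact: shuffle0l.
rewrite shuffle_linearl IH -word_nil shuffle_word.
by have /= := revK s; case: (rev s) => [<-|x u <-].
Qed.

(* Two bilinear maps that agree on words are equal. *)
Lemma bilinear_ext (A B : frakH -> frakH -> frakH) :
  (forall c x y z, A (c *: x + y) z = c *: A x z + A y z) ->
  (forall c x y z, A x (c *: y + z) = c *: A x y + A x z) ->
  (forall c x y z, B (c *: x + y) z = c *: B x z + B y z) ->
  (forall c x y z, B x (c *: y + z) = c *: B x y + B x z) ->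
  (forall s t, A (word s) (word t) = B (word s) (word t)) ->
  forall x y, A x y = B x y.
Proof.
move=> Al Ar Bl Br AB.
have A0l z : A 0 z = 0 by have := Al (-1) 0 0 z; rewrite scaler0 addr0 scaleN1r addNr.
have B0l z : B 0 z = 0 by have := Bl (-1) 0 0 z; rewrite scaler0 addr0 scaleN1r addNr.
have A0r z : A z 0 = 0 by have := Ar (-1) z 0 0; rewrite scaler0 addr0 scaleN1r addNr.
have B0r z : B z 0 = 0 by have := Br (-1) z 0 0; rewrite scaler0 addr0 scaleN1r addNr.
have ABw s y : A (word s) y = B (word s) y.
  elim/H_ind: y => [|c t y IH]; first by rewrite A0r B0r.
  by rewrite [LHS]Ar [RHS]Br AB IH.
move=> x y; elim/H_ind: x => [|c s x IH]; first by rewrite A0l B0l.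
by rewrite [LHS]Al [RHS]Bl ABw IH.
Qed.

Lemma shuffle_bl f h : shuffle (f * gb) h = shuffle f h * gb.
Proof.
apply: (@bilinear_ext (fun f h => shuffle (f * gb) h)
                      (fun f h => shuffle f h * gb)) f h => [c x y z|c x y z|c x y z|c x y z|s t].
- by rewrite mulH_linearl; exact: shuffle_linearl.
- exact: shuffle_linearr.
- by rewrite shuffle_linearl; exact: mulH_linearl.
- by rewrite shuffle_linearr; exact: mulH_linearl.
rewrite word_cat !shuffle_word rev_cat; move: (rev s) (rev t) => u v.
case: v => [|y v]; last exact: erefl.
rewrite -[LHS]/(word (rev (true :: u))) rev_cons -cats1 -word_cat.
by case: u.
Qed.

Lemma shuffle_br f h : shuffle f (h * gb) = shuffle f h * gb.
Proof.
apply: (@bilinear_ext (fun f h => shuffle f (h * gb))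
                      (fun f h => shuffle f h * gb)) f h => [c x y z|c x y z|c x y z|c x y z|s t].
- exact: shuffle_linearl.
- by rewrite mulH_linearl; exact: shuffle_linearr.
- by rewrite shuffle_linearl; exact: mulH_linearl.
- by rewrite shuffle_linearr; exact: mulH_linearl.
rewrite word_cat !shuffle_word rev_cat; move: (rev s) (rev t) => u v.
rewrite -[rev [:: true] ++ v]/(true :: v).
elim: u => [|x u IHu].
  by rewrite -[LHS]/(word (rev (true :: v))) rev_cons -cats1 -word_cat.
case: x; last exact: erefl.
rewrite -[LHS]/(shuffle_rev u (true :: v) * gb) IHu; congr (_ * gb).
case: v {IHu} => [|y v]; last exact: erefl.
rewrite -[RHS]/(word (rev (true :: u))) rev_cons -cats1 -word_cat.
by case: u.
Qed.

Lemma shuffle_aa f h : shuffle (f * ga) (h * ga) =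
  (shuffle (f * ga) h + shuffle f (h * ga) + hbar *: shuffle f h) * ga.
Proof.
have lin (c : {poly rat}) (x y x' y' x'' y'' p q r : frakH) :
    p = c *: x + y -> q = c *: x' + y' -> r = c *: x'' + y'' ->
    (p + q + hbar *: r) * ga =
    c *: ((x + x' + hbar *: x'') * ga) + (y + y' + hbar *: y'') * ga.
  move=> -> -> ->; rewrite -[RHS]mulH_linearl; congr (_ * ga).
  rewrite !scalerDr !scalerA [hbar * c]mulrC.
  by rewrite [RHS]addrACA; congr (_ + _); exact: addrACA.
apply: (@bilinear_ext (fun f h => shuffle (f * ga) (h * ga))
  (fun f h => (shuffle (f * ga) h + shuffle f (h * ga) + hbar *: shuffle f h) * ga)) f h
   => [c x y z|c x y z|c x y z|c x y z|s t].
- by rewrite mulH_linearl; exact: shuffle_linearl.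
- by rewrite mulH_linearl; exact: shuffle_linearr.
- apply: lin; try exact: shuffle_linearl.
  by rewrite mulH_linearl; exact: shuffle_linearl.
- apply: lin; try exact: shuffle_linearr.
  by rewrite mulH_linearl; exact: shuffle_linearr.
by rewrite !word_cat !shuffle_word !rev_cat.
Qed.

(* Codes of the factors of a word b a^{k_1} ... b a^{k_r}. *)
Definition parse_step (acc : seq nat) (x : bool) : seq nat :=
  if x then 0%N :: acc else if acc is k :: acc' then k.+1 :: acc' else [::].
Definition parse (w : seq bool) : seq nat := rev (foldl parse_step [::] w).

(* The word b a^{k_1} ... b a^{k_r}. *)
Definition spell (s : seq nat) : seq bool :=
  flatten [seq true :: nseq k false | k <- s].

Lemma spellK : cancel spell parse.
Proof.
suff E s acc : foldl parse_step acc (spell s) = rev s ++ acc.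
  by move=> s; rewrite /parse E cats0 revK.
elim: s acc => [|k s IH] acc //.
rewrite /spell /= foldl_cat IH rev_cons cat_rcons; congr (_ ++ _).
suff -> m : foldl parse_step (m :: acc) (nseq k false) = (m + k)%N :: acc by [].
by elim: k m => [|k IHk] m; [rewrite addn0 | rewrite /= IHk addSnnS].
Qed.

Lemma monomialE s : monomial s = hbar ^+ count_mem 0%N s *: word (spell s).
Proof.
elim: s => [|k s IH]; first by rewrite /monomial big_nil scale1r word_nil.
rewrite /monomial big_cons -/(monomial s) IH; case: k => [|k] /=.
  rewrite e1_sub_g1 -scalerAl -scalerAr scalerA -exprS.
  by rewrite word_cat.
rewrite add0n -scalerAr; congr (_ *: _).
suff -> : gk k.+1 = word (true :: nseq k.+1 false) by rewrite word_cat.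
suff E m : ga ^+ m = word (nseq m false) by rewrite /gk E word_cat.
by elim: m => [|m IHm]; rewrite ?word_nil // exprS IHm word_cat.
Qed.

Section Integrals.
Variable R : realType.
Implicit Types (omega : R) (t : R[i]).
Local Open Scope complex_scope.

Definition cexp (z : R[i]) : R[i] :=
  (expR (complex.Re z) * cos (complex.Im z)) +i* (expR (complex.Re z) * sin (complex.Im z)).

Definition two_pi_i : R[i] := (2 * pi) *i.

Definition hbarC omega : R[i] := two_pi_i * omega%:C.

Definition evalC omega (p : {poly rat}) : R[i] :=
  (map_poly ratr p).[hbarC omega].

Definition Iomega omega (k : nat) t : R[i] :=
  if k is 0 then hbarC omega
  else (hbarC omega / (cexp (- hbarC omega * t) - 1)) ^+ k.

Definition cintegral (f : R -> R[i]) : R[i] :=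
  Rintegral lebesgue_measure setT (fun y => complex.Re (f y)) +i*
  Rintegral lebesgue_measure setT (fun y => complex.Im (f y)).

(* Integral over -ep + i R, oriented upwards; the factor 'i comes from dt. *)
Definition line_integral (ep : R) (f : R[i] -> R[i]) : R[i] :=
  'i%C * cintegral (fun y => f ((- ep) +i* y)).

Fixpoint iterated_integral (ep : R) (r : nat) (F : seq R[i] -> R[i]) : R[i] :=
  if r is r'.+1 then
    line_integral ep
      (fun t => iterated_integral ep r' (fun ts => F (t :: ts)))
  else F [::].

Definition Zintegrand omega (s : seq nat) (ts : seq R[i]) : R[i] :=
  (\prod_(a < size s) (cexp (two_pi_i * ts`_a) - 1)^-1) *
  \prod_(a < size s) Iomega omega (nth 0%N s a) (\sum_(b < a.+1) ts`_b).

Definition Zmonomial omega (eps : nat -> R) (s : seq nat) : R[i] :=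
  iterated_integral (eps (size s)) (size s) (Zintegrand omega s).

(* The linear extension of Zmonomial from the basis of admissible monomials:
   monomial s is hbar^n times a word, where n is the number of letters
   e_1 - g_1 in s, so the coordinate of f on it is the coefficient of f on that
   word divided by hbar^n (see Zomega_sum). Outside H0hat it has no meaning. *)
Definition Zomega omega (eps : nat -> R) (f : frakH) : R[i] :=
  \sum_(w <- msupp f)
    let s := parse (fmonom_val w) in
    evalC omega (drop_poly (count_mem 0%N s) (mcoeff w f)) *
    Zmonomial omega eps s.

End Integrals.

Section ZomegaTheory.
Variables (R : realType) (omega : R) (eps : nat -> R).

Let F (w : fmonom bool) (x : {poly rat}) : R[i] :=
  let s := parse (fmonom_val w) in
  evalC omega (drop_poly (count_mem 0%N s) x) * Zmonomial omega eps s.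

Lemma evalCD p q : evalC omega (p + q) = evalC omega p + evalC omega q.
Proof. by rewrite /evalC rmorphD hornerD. Qed.

Let FD w x y : F w (x + y) = F w x + F w y.
Proof. by rewrite /F /= raddfD evalCD mulrDl. Qed.

Lemma Zomega_sum (cs : seq ({poly rat} * seq nat)) :
  Zomega omega eps (\sum_(p <- cs) p.1 *: monomial p.2) =
  \sum_(p <- cs) evalC omega p.1 * Zmonomial omega eps p.2.
Proof.
elim: cs => [|[c s] cs IH]; first by rewrite !big_nil /Zomega msupp0 big_seq_fset0.
rewrite !big_cons -IH /= /Zomega monomialE scalerA.
rewrite (@sum_msupp_lin _ F _ _ _ FD); congr (_ + _).
rewrite (@sum_msupp_word _ (fun w x => F w (c * hbar ^+ count_mem 0%N s * x))).
by rewrite /F /= spellK mulr1 drop_polyMXn_id.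
Qed.

Lemma Zomega_linear c x y : H0hat x -> H0hat y ->
  Zomega omega eps (c *: x + y) =
  evalC omega c * Zomega omega eps x + Zomega omega eps y.
Proof.
move=> [cs [_ ->]] [ds [_ ->]].
rewrite scaler_sumr; under eq_bigr do rewrite scalerA.
have := Zomega_sum ([seq (c * p.1, p.2) | p <- cs] ++ ds).
rewrite !big_cat !big_map /= => ->; rewrite !Zomega_sum mulr_sumr.
congr (_ + _); apply: eq_bigr => p _.
by rewrite mulrA /evalC rmorphM hornerM.
Qed.

Lemma Zomega_monomial s :
  Zomega omega eps (monomial s) = Zmonomial omega eps s.
Proof.
have := Zomega_sum [:: (1, s)]; rewrite !big_seq1 scale1r => ->.
by rewrite /evalC rmorph1 hornerC mul1r.
Qed.

Lemma Zomega1 : Zomega omega eps 1 = 1.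
Proof.
have -> : 1 = monomial [::] by rewrite /monomial big_nil.
by rewrite Zomega_monomial /Zmonomial /= /Zintegrand !big_ord0 mulr1.
Qed.

End ZomegaTheory.

(* Main.v *)
From HB Require Import structures.
Require Import Defs.
From mathcomp Require Import finmap.
From mathcomp Require Import zify.
From mathcomp Require Import all_boot all_order all_algebra.
From mathcomp Require Import all_classical all_reals all_analysis.
From mathcomp Require Import measurable_realfun complex ring lra.
From mathcomp Require Import -(notations) monalg.

(* Read a word in a and b from the left as an operator on functions of T: the letter
   b integrates against dt/(e^{2 pi i t} - 1) after T -> T + t, the letter a multiplies
   by G(T) = I_omega(g_1 | T). The value at T = 0 of the operator of w applied to 1 is
   the iterated integral Z_omega(w), up to a power of hbar for the letters e_1 - g_1.
   If the operators of u and v act on K(T + T') in T and T' separately, then Fubini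
   lets a final b be moved into K, and the partial fraction
   G(T) G(T') = G(T + T') (G(T) + G(T') + hbar) treats two final letters a, so the
   value at T = T' = 0 obeys the recursion of the shuffle product; for K = 1 it is the
   product Z_omega(u) Z_omega(v). The three integrals involved a priori use different
   contours; that they may be moved follows from holomorphy, used in the discrete form
   that the integral over Re t = x changes by O(d^2) when x changes by d. *)

Set Implicit Arguments.
Unset Strict Implicit.
Unset Printing Implicit Defensive.

Import Order.TTheory GRing.Theory Num.Theory.
Import numFieldNormedType.Exports.
Local Open Scope classical_set_scope.
Local Open Scope ring_scope.
Local Open Scope complex_scope.

(** * Integrals of complex-valued functions *)

(** Convergence dictates the form of the statements. For y -> +oo the kernel 1/(e^{2 pi i t} - 1)
    tends to -1, so b applied to a constant diverges; decay must come from a letter a further right,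
    G(x + i y) being O(e^{- 2 pi omega y}). Hence functions are measured by a one-sided weight e^{-
    m y}. Both letters preserve it, and since it is multiplicative, K(T + T') is bounded by a
    product of weights, as Fubini requires. The price is that the constant 1 is not in this class:
    it enters only after a last letter a has acted on it, and the recursion for K = 1 needs its own
    first step. The poles of G dictate the contours. After r letters b, Re T = - r e, which must
    stay right of the pole -1/omega. Since T + T' descends to - (r + s) e, the product is computed
    with the offset admissible for r + s integrations, and each factor is moved there. A contour is
    moved by n steps of size O(1/n), each costing O(1/n^2), so the total change vanishes in the
    limit; no complex derivative or Cauchy theorem is involved. *)

Section ComplexModulus.
Variable R : realType.
Implicit Types z : R[i].
Notation Re := (@complex.Re R).
Notation Im := (@complex.Im R).
Notation normc := (@Normc.normc R).

Lemma normc_sqrt z : normc z = Num.sqrt (Re z ^+ 2 + Im z ^+ 2).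
Proof. by case: z. Qed.

Lemma normc_ge0 z : 0 <= normc z.
Proof. by rewrite normc_sqrt sqrtr_ge0. Qed.

Lemma sqr_normc_Re_Im z : normc z ^+ 2 = Re z ^+ 2 + Im z ^+ 2.
Proof. by rewrite normc_sqrt sqr_sqrtr // addr_ge0 ?sqr_ge0. Qed.

Lemma normc_Re z : `|Re z| <= normc z.
Proof.
rewrite -(@ler_pXn2r _ 2) ?nnegrE ?normc_ge0 // sqr_normc_Re_Im real_normK ?num_real //.
by rewrite lerDl sqr_ge0.
Qed.

Lemma normc_Im z : `|Im z| <= normc z.
Proof.
rewrite -(@ler_pXn2r _ 2) ?nnegrE ?normc_ge0 // sqr_normc_Re_Im real_normK ?num_real //.
by rewrite lerDr sqr_ge0.
Qed.

Lemma normc_le_ReIm z : normc z <= `|Re z| + `|Im z|.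
Proof.
rewrite -(@ler_pXn2r _ 2) ?nnegrE ?normc_ge0 ?addr_ge0 // sqr_normc_Re_Im.
rewrite sqrrD !real_normK ?num_real // -addrA lerD2l lerDr.
by rewrite mulrn_wge0 // mulr_ge0.
Qed.

Lemma normc_real (r : R) : normc r%:C = `|r|.
Proof. by rewrite normc_sqrt /= expr0n addr0 sqrtr_sqr. Qed.

Lemma normc_i : normc 'i%C = 1.
Proof. by rewrite normc_sqrt /= expr0n add0r expr1n sqrtr1. Qed.

Lemma ReD z1 z2 : Re (z1 + z2) = Re z1 + Re z2. Proof. by case: z1 z2 => ? ? []. Qed.
Lemma ImD z1 z2 : Im (z1 + z2) = Im z1 + Im z2. Proof. by case: z1 z2 => ? ? []. Qed.
Lemma ReM z1 z2 : Re (z1 * z2) = Re z1 * Re z2 - Im z1 * Im z2.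
Proof. by case: z1 z2 => ? ? []. Qed.
Lemma ImM z1 z2 : Im (z1 * z2) = Re z1 * Im z2 + Im z1 * Re z2.
Proof. by case: z1 z2 => ? ? []. Qed.
Lemma ReN z : Re (- z) = - Re z. Proof. by case: z. Qed.
Lemma ImN z : Im (- z) = - Im z. Proof. by case: z. Qed.

End ComplexModulus.

Section ComplexMeasurable.
Variable R : realType.
Notation Re := (@complex.Re R).
Notation Im := (@complex.Im R).
Notation normc := (@Normc.normc R).

Definition cmeasurable d (T : measurableType d) (f : T -> R[i]) : Prop :=
  measurable_fun setT (fun t => Re (f t)) /\ measurable_fun setT (fun t => Im (f t)).

Section One.
Context d (T : measurableType d).
Implicit Types f g : T -> R[i].

Lemma cmeasurable_cst (c : R[i]) : cmeasurable (fun _ : T => c).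
Proof. by split; exact: measurable_cst. Qed.

Lemma cmeasurableD f g : cmeasurable f -> cmeasurable g ->
  cmeasurable (fun t => f t + g t).
Proof.
move=> [f1 f2] [g1 g2]; split.
- by under eq_fun do rewrite ReD; exact: measurable_funD.
- by under eq_fun do rewrite ImD; exact: measurable_funD.
Qed.

Lemma cmeasurableM f g : cmeasurable f -> cmeasurable g ->
  cmeasurable (fun t => f t * g t).
Proof.
move=> [f1 f2] [g1 g2]; split.
- by under eq_fun do rewrite ReM; apply: measurable_funB; exact: measurable_funM.
- by under eq_fun do rewrite ImM; apply: measurable_funD; exact: measurable_funM.
Qed.

Lemma cmeasurableN f : cmeasurable f -> cmeasurable (fun t => - f t).
Proof.
move=> [f1 f2]; split.
- by under eq_fun do rewrite ReN; exact: measurable_funN.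
- by under eq_fun do rewrite ImN; exact: measurable_funN.
Qed.

Lemma cmeasurableV f : cmeasurable f -> cmeasurable (fun t => (f t)^-1).
Proof.
move=> [f1 f2].
have mn : measurable_fun setT (fun t => (Re (f t) ^+ 2 + Im (f t) ^+ 2)^-1).
  (* For nonnegative reals [powR] with exponent -1 agrees with the inverse, at 0 as well, so zeros
     of [f] need no case distinction. *)
  under eq_fun do rewrite -powR_inv1 ?addr_ge0 ?sqr_ge0 //.
  apply: (@measurableT_comp _ _ _ _ _ _ (fun x : R => x `^ (- 1))).
    exact: measurable_powR.
  by apply: measurable_funD; exact: measurable_funX.
split.
- rewrite (_ : (fun t => _) = fun t => Re (f t) * (Re (f t) ^+ 2 + Im (f t) ^+ 2)^-1).
    exact: measurable_funM.
  by apply/funext => t; case: (f t).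
- rewrite (_ : (fun t => _) = fun t => - (Im (f t) * (Re (f t) ^+ 2 + Im (f t) ^+ 2)^-1)).
    by apply: measurable_funN; exact: measurable_funM.
  by apply/funext => t; case: (f t) => a b /=.
Qed.

Lemma cmeasurable_comp d' (T' : measurableType d') (h : T' -> T) f :
  measurable_fun setT h -> cmeasurable f -> cmeasurable (fun t => f (h t)).
Proof.
move=> mh [f1 f2]; split.
- exact: (measurableT_comp f1 mh).
- exact: (measurableT_comp f2 mh).
Qed.

End One.

Lemma cmeasurable_pair1 d1 d2 (T1 : measurableType d1) (T2 : measurableType d2)
  (f : T1 * T2 -> R[i]) (t : T2) :
  cmeasurable f -> cmeasurable (fun s => f (s, t)).
Proof.
move=> [m1 m2]; split.
- exact: (@measurable_fun_pair1 _ _ _ T1 T2 R _ t m1).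
- exact: (@measurable_fun_pair1 _ _ _ T1 T2 R _ t m2).
Qed.

Lemma cmeasurable_pair2 d1 d2 (T1 : measurableType d1) (T2 : measurableType d2)
  (f : T1 * T2 -> R[i]) (s : T1) :
  cmeasurable f -> cmeasurable (fun t => f (s, t)).
Proof.
move=> [m1 m2]; split.
- exact: (@measurable_fun_pair2 _ _ _ T1 T2 R _ s m1).
- exact: (@measurable_fun_pair2 _ _ _ T1 T2 R _ s m2).
Qed.

Lemma cmeasurable_shift (y : R) (f : measurableTypeR R -> R[i]) :
  cmeasurable f -> cmeasurable (fun t : measurableTypeR R => f (y + t)).
Proof.
apply: (cmeasurable_comp (h := fun t : measurableTypeR R => (y + t : measurableTypeR R))).
exact: (@measurable_funD _ (measurableTypeR R) R setT (cst y) id).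
Qed.

End ComplexMeasurable.

(** * Domination, translation invariance and Fubini *)

Section ComplexIntegral.
Variable R : realType.
Notation Re := (@complex.Re R).
Notation Im := (@complex.Im R).
Notation normc := (@Normc.normc R).
Notation mu := (@lebesgue_measure R).
Implicit Types (f g : R -> R[i]) (w : R -> R).

Definition cintegrable f : Prop :=
  mu.-integrable setT (EFin \o (fun y => Re (f y))) /\
  mu.-integrable setT (EFin \o (fun y => Im (f y))).

Lemma integrable_dom (h : R -> R) w : mu.-integrable setT (EFin \o w) ->
  measurable_fun setT h -> (forall y, `|h y| <= w y) ->
  mu.-integrable setT (EFin \o h).
Proof.
move=> iw mh hw; apply: (le_integrable _ _ _ iw) => //.
  exact/measurable_EFinP.
move=> y _ /=; rewrite lee_fin; apply: (le_trans (hw y)); exact: ler_norm.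
Qed.

Lemma cintegrable_dom f w : mu.-integrable setT (EFin \o w) ->
  cmeasurable f -> (forall y, normc (f y) <= w y) -> cintegrable f.
Proof.
move=> iw [m1 m2] fw; split; apply: (integrable_dom iw) => // y;
  apply: le_trans (fw y); [exact: normc_Re|exact: normc_Im].
Qed.

Lemma cintegralD f g : cintegrable f -> cintegrable g ->
  cintegral (fun y => f y + g y) = cintegral f + cintegral g.
Proof.
move=> [f1 f2] [g1 g2]; rewrite /cintegral; congr (_ +i* _).
- by under eq_Rintegral do rewrite ReD; exact: RintegralD.
- by under eq_Rintegral do rewrite ImD; exact: RintegralD.
Qed.

Lemma cintegralZ (c : R[i]) f : cintegrable f ->
  cintegral (fun y => c * f y) = c * cintegral f.
Proof.
move=> [f1 f2]; rewrite /cintegral; case: c => a b.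
have iZ (r : R) (h : R -> R) : mu.-integrable setT (EFin \o h) ->
    mu.-integrable setT (EFin \o (fun y => r * h y)).
  move=> ih; rewrite (_ : EFin \o _ = fun y => (r%:E * (EFin \o h) y)%E) //.
  exact: integrableZl.
apply/eqP; rewrite eq_complex; apply/andP; split; apply/eqP.
- under [LHS]eq_Rintegral do rewrite ReM /=.
  rewrite RintegralB //; [|exact: iZ|exact: iZ].
  by rewrite !RintegralZl.
- under [LHS]eq_Rintegral do rewrite ImM /=.
  rewrite RintegralD //; [|exact: iZ|exact: iZ].
  by rewrite !RintegralZl.
Qed.

Lemma cintegrableD f g : cintegrable f -> cintegrable g ->
  cintegrable (fun y => f y + g y).
Proof.
move=> [f1 f2] [g1 g2]; split.
- rewrite (_ : EFin \o _ = ((EFin \o (fun y => Re (f y))) \+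
    (EFin \o (fun y => Re (g y))))%E); first exact: integrableD.
  by apply/funext => y /=; rewrite ReD.
- rewrite (_ : EFin \o _ = ((EFin \o (fun y => Im (f y))) \+
    (EFin \o (fun y => Im (g y))))%E); first exact: integrableD.
  by apply/funext => y /=; rewrite ImD.
Qed.

Lemma cintegrableZ (c : R[i]) f : cintegrable f -> cintegrable (fun y => c * f y).
Proof.
move=> [f1 f2].
have iZ (r : R) (h : R -> R) : mu.-integrable setT (EFin \o h) ->
    mu.-integrable setT (fun y => (r%:E * (EFin \o h) y)%E).
  exact: integrableZl.
split.
- rewrite (_ : EFin \o _ = ((fun y => ((Re c)%:E * (EFin \o (fun y => Re (f y))) y)) \-
    (fun y => ((Im c)%:E * (EFin \o (fun y => Im (f y))) y)))%E).
    by apply: integrableB => //; exact: iZ.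
  by apply/funext => y /=; rewrite ReM.
- rewrite (_ : EFin \o _ = ((fun y => ((Re c)%:E * (EFin \o (fun y => Im (f y))) y)) \+
    (fun y => ((Im c)%:E * (EFin \o (fun y => Re (f y))) y)))%E).
    by apply: integrableD => //; exact: iZ.
  by apply/funext => y /=; rewrite ImM.
Qed.

Lemma cintegrableB f g : cintegrable f -> cintegrable g ->
  cintegrable (fun y => f y - g y).
Proof.
move=> fi gi; under eq_fun do rewrite -mulN1r.
by apply: cintegrableD => //; exact: cintegrableZ.
Qed.

Lemma cintegralB f g : cintegrable f -> cintegrable g ->
  cintegral (fun y => f y - g y) = cintegral f - cintegral g.
Proof.
move=> fi gi; under eq_fun do rewrite -mulN1r.
by rewrite (cintegralD fi (cintegrableZ _ gi)) (cintegralZ _ gi) mulN1r.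
Qed.

Lemma Rintegral_dom (h : R -> R) w : mu.-integrable setT (EFin \o w) ->
  measurable_fun setT h -> (forall y, `|h y| <= w y) ->
  `|Rintegral mu setT h| <= Rintegral mu setT w.
Proof.
move=> iw mh hw; have ih := integrable_dom iw mh hw.
apply: (le_trans (le_normr_Rintegral _ ih)) => //.
apply: le_Rintegral => //.
exact: (integrable_norm ih).
Qed.

(** Real and imaginary parts are bounded separately, whence the factor 2; later only the order of
    magnitude counts. *)
Lemma normc_cintegral_le f w : mu.-integrable setT (EFin \o w) ->
  cmeasurable f -> (forall y, normc (f y) <= w y) ->
  normc (cintegral f) <= 2 * Rintegral mu setT w.
Proof.
move=> iw [m1 m2] fw; apply: (le_trans (normc_le_ReIm _)).
rewrite mulr_natl mulr2n; apply: lerD; apply: Rintegral_dom => // y;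
  apply: le_trans (fw y); [exact: normc_Re|exact: normc_Im].
Qed.

Lemma normc_cintegral_leM (c : R) f w : mu.-integrable setT (EFin \o w) ->
  cmeasurable f -> (forall y, normc (f y) <= c * w y) ->
  normc (cintegral f) <= 2 * c * Rintegral mu setT w.
Proof.
move=> iw mf fw.
have icw : mu.-integrable setT (EFin \o (fun y => c * w y)).
  rewrite (_ : EFin \o _ = fun y => (c%:E * (EFin \o w) y)%E) //.
  exact: integrableZl.
by have := normc_cintegral_le icw mf fw; rewrite RintegralZl // mulrA.
Qed.

Lemma measurable_shift (d : R) :
  measurable_fun setT ((fun y : R => y + d) : measurableTypeR R -> measurableTypeR R).
Proof. exact: (@measurable_funD _ (measurableTypeR R) R setT id (cst d)). Qed.

(** Lebesgue measure is determined by its values on half-open intervals, and translation preserves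
    their lengths. *)
Lemma lebesgue_measure_shift (d : R) (A : set (measurableTypeR R)) : measurable A ->
  pushforward mu ((fun y : R => y + d) : _ -> measurableTypeR R) A = mu A.
Proof.
move=> mA.
pose mixin := isMeasurableFun.Build _ _ _ _ _ (measurable_shift d).
pose h : {mfun measurableTypeR R >-> measurableTypeR R} :=
  HB.pack ((fun y : R => y + d) : measurableTypeR R -> measurableTypeR R) mixin.
change (pushforward mu h A = mu A).
apply/esym/lebesgue_measure_unique => //= _ [[a b]] /= _ <-.
rewrite /pushforward (_ : _ @^-1` _ = `]a - d, b - d]%classic).
  rewrite !lebesgue_measure_itv /= !lte_fin ltrD2r; case: ifP => // _.
  by rewrite -!EFinB; congr EFin; ring.
by apply/seteqP; split => y /=; rewrite !in_itv /= ltrBlDr lerBrDr.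
Qed.

Lemma ge0_integral_shift (d : R) (k : R -> \bar R) :
  measurable_fun setT k -> (forall y, 0 <= k y)%E ->
  integral mu setT (fun y : R => k (y + d)) = integral mu setT k.
Proof.
move=> mk k0.
have E := @ge0_integral_pushforward _ _ _ _ R _ (measurable_shift d) mu setT k measurableT mk
  (fun y _ => k0 y).
rewrite preimage_setT in E; rewrite -[LHS]E.
apply: eq_measure_integral; first exact: measurable_shift.
by move=> mh A mA _; exact: (lebesgue_measure_shift d mA).
Qed.

(** Positive and negative parts are translated separately, so the equality also holds when [fine]
    returns a default value. *)
Lemma Rintegral_shift (d : R) (h : R -> R) : measurable_fun setT h ->
  Rintegral mu setT (fun y => h (y + d)) = Rintegral mu setT h.
Proof.
move=> mh; rewrite /Rintegral integralE [X in _ = fine X]integralE.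
congr (fine (_ - _)%E).
- have mp : measurable_fun setT (EFin \o h)^\+%E.
    by apply/measurable_funepos/measurable_EFinP.
  by rewrite -(ge0_integral_shift d mp) //; apply: eq_integral => y _; rewrite !funepos.unlock.
- have mn : measurable_fun setT (EFin \o h)^\-%E.
    by apply/measurable_funeneg/measurable_EFinP.
  by rewrite -(ge0_integral_shift d mn) //; apply: eq_integral => y _; rewrite !funeneg.unlock.
Qed.

Lemma cintegral_shift (d : R) f : cmeasurable f ->
  cintegral (fun y => f (y + d)) = cintegral f.
Proof.
move=> [m1 m2]; rewrite /cintegral; congr (_ +i* _).
- exact: (Rintegral_shift d m1).
- exact: (Rintegral_shift d m2).
Qed.

Lemma measurable_Rintegral_param d (T : measurableType d) (h : T * measurableTypeR R -> R) :
  measurable_fun setT h ->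
  measurable_fun setT (fun t => Rintegral mu setT (fun y => h (t, y))).
Proof.
move=> mh; rewrite /Rintegral; apply: measurableT_comp => //.
under eq_fun do rewrite integralE.
apply: emeasurable_funB.
- have mp : measurable_fun setT (EFin \o h)^\+%E.
    by apply/measurable_funepos/measurable_EFinP.
  have F := @measurable_fun_fubini_tonelli_F _ _ _ _ _ mu _ mp (fun y => funepos_ge0 _ y).
  apply: (eq_measurable_fun _ _ F) => t _; rewrite /fubini_F.
  by apply: eq_integral => y _; rewrite !funepos.unlock.
- have mn : measurable_fun setT (EFin \o h)^\-%E.
    by apply/measurable_funeneg/measurable_EFinP.
  have F := @measurable_fun_fubini_tonelli_F _ _ _ _ _ mu _ mn (fun y => funeneg_ge0 _ y).
  apply: (eq_measurable_fun _ _ F) => t _; rewrite /fubini_F.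
  by apply: eq_integral => y _; rewrite !funeneg.unlock.
Qed.

Lemma cmeasurable_cintegral d (T : measurableType d) (f : T * measurableTypeR R -> R[i]) :
  cmeasurable f -> cmeasurable (fun t => cintegral (fun y => f (t, y))).
Proof.
move=> [m1 m2]; split.
- exact: (measurable_Rintegral_param m1).
- exact: (measurable_Rintegral_param m2).
Qed.

Lemma Rintegral_swap (h : measurableTypeR R * measurableTypeR R -> R) (w1 w2 : R -> R) :
  mu.-integrable setT (EFin \o w1) -> mu.-integrable setT (EFin \o w2) ->
  (forall y, 0 <= w1 y) -> (forall y, 0 <= w2 y) ->
  measurable_fun setT h -> (forall s t, `|h (s, t)| <= w1 s * w2 t) ->
  Rintegral mu setT (fun s => Rintegral mu setT (fun t => h (s, t))) =
  Rintegral mu setT (fun t => Rintegral mu setT (fun s => h (s, t))).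
Proof.
move=> i1 i2 p1 p2 mh hw.
have ih : (mu \x mu)%E.-integrable setT (EFin \o h).
  apply/integrable12ltyP; first exact/measurable_EFinP.
  have fin2 : (\int[mu]_t (w2 t)%:E)%E \is a fin_num by exact: (integrable_fin_num _ i2).
  apply: (@le_lt_trans _ _ (\int[mu]_s ((w1 s)%:E * (\int[mu]_t (w2 t)%:E)))%E).
    apply: ge0_le_integral => //.
    - by move=> s _; exact: integral_ge0.
    - have ma : measurable_fun setT (fun p => `|(h p)%:E|%E).
        by apply: measurableT_comp => //; exact/measurable_EFinP.
      exact: (@measurable_fun_fubini_tonelli_F _ _ _ _ _ mu _ ma (fun p => abse_ge0 _)).
    - apply: emeasurable_funM => //; exact: (measurable_int _ i1).
    move=> s _; rewrite -ge0_integralZl //; last first.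
    - by rewrite lee_fin.
    - by move=> t _; rewrite lee_fin.
    - exact: (measurable_int _ i2).
    apply: ge0_le_integral => //.
    - apply: measurableT_comp => //; apply/measurable_EFinP.
      exact: (@measurable_fun_pair2 _ _ _ (measurableTypeR R) (measurableTypeR R) R h s).
    - by apply: emeasurable_funM => //; exact: (measurable_int _ i2).
    - by move=> t _; rewrite /= -EFinM lee_fin.
  have [r ->] : exists r, (\int[mu]_t (w2 t)%:E)%E = r%:E.
    by exists (fine (\int[mu]_t (w2 t)%:E)); rewrite fineK.
  have := integrableZr measurableT r i1 => /integrable_fin_num /= => /(_ measurableT).
  by rewrite /comp /= => F; rewrite ltey_eq F.
(* Finite inner integrals allow the inner [fine] to be removed, which reduces the claim to Fubini
   for extended reals. *)
have int1 s : (\int[mu]_t (h (s, t))%:E)%E \is a fin_num.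
  apply: (@integrable_fin_num _ _ _ mu) => //.
  apply: (@integrable_dom _ (fun t => w1 s * w2 t)) => //.
  - rewrite (_ : EFin \o _ = fun t => ((w1 s)%:E * (EFin \o w2) t)%E) //.
    exact: integrableZl.
  - exact: (@measurable_fun_pair2 _ _ _ (measurableTypeR R) (measurableTypeR R) R h s).
have int2 t : (\int[mu]_s (h (s, t))%:E)%E \is a fin_num.
  apply: (@integrable_fin_num _ _ _ mu) => //.
  apply: (@integrable_dom _ (fun s => w2 t * w1 s)) => //.
  - rewrite (_ : EFin \o _ = fun s => ((w2 t)%:E * (EFin \o w1) s)%E) //.
    exact: integrableZl.
  - exact: (@measurable_fun_pair1 _ _ _ (measurableTypeR R) (measurableTypeR R) R h t).
  - by move=> s; rewrite mulrC.
rewrite /Rintegral; congr fine.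
under eq_integral do rewrite fineK //.
under [RHS]eq_integral do rewrite fineK //.
exact: (Fubini ih).
Qed.

Lemma cintegral_swap (f : measurableTypeR R * measurableTypeR R -> R[i]) (w1 w2 : R -> R) :
  mu.-integrable setT (EFin \o w1) -> mu.-integrable setT (EFin \o w2) ->
  (forall y, 0 <= w1 y) -> (forall y, 0 <= w2 y) ->
  cmeasurable f -> (forall s t, normc (f (s, t)) <= w1 s * w2 t) ->
  cintegral (fun s => cintegral (fun t => f (s, t))) =
  cintegral (fun t => cintegral (fun s => f (s, t))).
Proof.
move=> i1 i2 p1 p2 [m1 m2] fw; rewrite /cintegral /=; congr (_ +i* _).
- apply: (Rintegral_swap i1 i2 p1 p2 m1) => s t.
  exact: (le_trans (normc_Re _)).
- apply: (Rintegral_swap i1 i2 p1 p2 m2) => s t.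
  exact: (le_trans (normc_Im _)).
Qed.

Lemma cintegrable_cintegral (f : measurableTypeR R * measurableTypeR R -> R[i])
    (w1 w2 : R -> R) :
  mu.-integrable setT (EFin \o w1) -> mu.-integrable setT (EFin \o w2) ->
  cmeasurable f -> (forall s t, normc (f (s, t)) <= w1 s * w2 t) ->
  cintegrable (fun s => cintegral (fun t => f (s, t))).
Proof.
move=> i1 i2 mf fw; set J := Rintegral mu setT w2.
have i3 : mu.-integrable setT (EFin \o (fun s => (2 * J) * w1 s)).
  rewrite (_ : EFin \o _ = fun s => ((2 * J)%:E * (EFin \o w1) s)%E) //.
  exact: integrableZl.
apply: (cintegrable_dom i3); first exact: cmeasurable_cintegral mf.
move=> s; apply: (le_trans (normc_cintegral_leM (c := w1 s) i2 _ (fw s))).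
  exact: (cmeasurable_pair2 (s : measurableTypeR R) mf).
by rewrite -/J mulrAC.
Qed.

Lemma integrable_expR_abs (m : R) : 0 < m ->
  mu.-integrable setT (EFin \o (fun y => expR (- m * `|y|))).
Proof.
move=> m0.
have ce : continuous (fun y : R => expR (- m * `|y|)).
  move=> y; apply: continuous_comp; last exact: continuous_expR.
  apply: continuousM; first exact: cst_continuous.
  exact: norm_continuous.
apply/integrableP; split.
  by apply/measurable_EFinP; exact: continuous_measurable_fun.
under eq_integral => y _ do rewrite /= ger0_norm ?expR_ge0 //.
rewrite ge0_symfun_integralT //; last first.
  by move=> y /=; rewrite normrN.
(* On the half-line the function is 1/m times the density of the exponential law. *)
have ip := integrable_exponential_pdf m0.
have ip2 := integrable_fin_num measurableT (integrableZl measurableT m^-1 ip).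
rewrite integral_mkcond /=.
rewrite (_ : (\int[mu]_x _)%E = (\int[mu]_x ((m^-1)%:E * (EFin \o exponential_pdf m) x)))%E.
  by rewrite -(fineK ip2) -EFinM ltry.
apply: eq_integral => y _; rewrite patchE.
case: ifPn => [|/negP]; rewrite inE /=.
  by move=> y0; rewrite exponential_pdfE //= -EFinM mulKf ?gt_eqF // ger0_norm.
move=> y0; rewrite lt0_exponential_pdf ?mule0 //.
by rewrite ltNge; apply/negP.
Qed.

End ComplexIntegral.

(** * The kernels 1/(exp(i alpha t) - 1) *)

Section Kernel.
Variable R : realType.
Notation Re := (@complex.Re R).
Notation Im := (@complex.Im R).
Notation normc := (@Normc.normc R).
Implicit Types (a b x y u : R) (alpha beta : R).

Lemma cexpD (z w : R[i]) : cexp (z + w) = cexp z * cexp w.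
Proof.
case: z w => [a b] [c d]; rewrite /cexp /= expRD cosD sinD.
by apply/eqP; rewrite eq_complex /=; apply/andP; split; apply/eqP; ring.
Qed.

Definition eexp alpha x y : R[i] := cexp (alpha *i * (x +i* y)).

(* At t = x + i y, [kern (2 * pi)] is 1/(e^{2 pi i t} - 1) and
   [kern (- (2 * pi * omega))] is I_omega(g_1 | t) / hbar. *)
Definition kern alpha x y : R[i] := (eexp alpha x y - 1)^-1.

Lemma eexpE alpha x y : eexp alpha x y =
  (expR (- alpha * y) * cos (alpha * x)) +i* (expR (- alpha * y) * sin (alpha * x)).
Proof. by rewrite /eexp /cexp /= !mul0r !add0r ?addr0 ?subr0 mulNr. Qed.

Lemma eexpD alpha x x' y y' :
  eexp alpha (x + x') (y + y') = eexp alpha x y * eexp alpha x' y'.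
Proof.
rewrite /eexp -cexpD -mulrDr; congr (cexp (_ * _)).
Qed.

Lemma cmeasurable_kern alpha x :
  @cmeasurable R _ (measurableTypeR R) (fun y => kern alpha x y).
Proof.
apply: cmeasurableV; apply: cmeasurableD; last exact: cmeasurable_cst.
have me : measurable_fun setT (fun y : R => expR (- alpha * y)).
  by apply: measurableT_comp => //; exact: measurable_funM.
split; under eq_fun do rewrite eexpE /=;
  by apply: measurable_funM => //; exact: measurable_cst.
Qed.

Lemma cos_lt1 u : 0 < `|u| < 2 * pi -> cos u < 1.
Proof.
move=> /andP[u0 u1]; rewrite -cos_norm.
have -> : `|u| = (`|u| / 2) *+ 2 by rewrite -mulr_natr divfK // pnatr_eq0.
have s0 : 0 < sin (`|u| / 2).
  by apply: sin_gt0_pi; rewrite divr_gt0 //= ltr_pdivrMr // mulrC.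
have := exprn_gt0 2 s0; rewrite cos_mulr2n sin2cos2; lra.
Qed.

(** For [a <= b] this puts the strip strictly between the pole 0 of [kern alpha] and one of the two
    neighbouring poles. *)
Definition off_period alpha a b :=
  forall x, a <= x <= b -> 0 < `|alpha * x| < 2 * pi.

Lemma normc_eexpB1 alpha x y :
  normc (eexp alpha x y - 1) ^+ 2 =
  expR (- alpha * y) ^+ 2 - 2 * expR (- alpha * y) * cos (alpha * x) + 1.
Proof.
rewrite sqr_normc_Re_Im eexpE /= subr0.
set r := expR _; have := cos2Dsin2 (alpha * x).
set c := cos _; set s := sin _ => h.
have -> : (r * c - 1) ^+ 2 + (r * s) ^+ 2 = r ^+ 2 * (c ^+ 2 + s ^+ 2) - 2 * r * c + 1 by ring.
by rewrite h; ring.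
Qed.

(** With r the modulus and k a bound on the cosine, r^2 - 2 k r + 1 = (1-k)/2 (1+r)^2 + (1+k)/2
    (1-r)^2. Compactness of [a, b] makes k < 1 uniform. *)
Lemma eexpB1_lower alpha a b : a <= b -> off_period alpha a b ->
  exists2 c : R, 0 < c & forall x y, a <= x <= b ->
    c * (1 + expR (- alpha * y)) <= normc (eexp alpha x y - 1).
Proof.
move=> ab off.
have cc : {within `[a, b], continuous (fun x => cos (alpha * x))}.
  apply: continuous_subspaceT => x; apply: continuous_comp; last exact: continuous_cos.
  by apply: continuousM => //; exact: cst_continuous.
have [x0 + cmax] := EVT_max ab cc.
rewrite in_itv /= => x0ab; have k1 := cos_lt1 (off _ x0ab).
(* With k >= 0 the constant c = (1 - k)/2 satisfies c^2 <= c, so the bound c (1+r)^2 on the square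
   suffices. *)
pose k := Num.max 0 (cos (alpha * x0)).
have k0 : 0 <= k by rewrite le_max lexx.
have kl : k < 1 by rewrite gt_max ltr01.
exists ((1 - k) / 2); first by lra.
move=> x y xab; have r0 := expR_gt0 (- alpha * y).
rewrite -(@ler_pXn2r _ 2) ?nnegrE ?normc_ge0 //; last first.
  by apply: mulr_ge0; lra.
rewrite normc_eexpB1; set r := expR _ in r0 *.
have ck : cos (alpha * x) <= k.
  by rewrite le_max cmax ?orbT // in_itv.
have h1 : 0 <= r * (k - cos (alpha * x)) by apply: mulr_ge0; lra.
have h2 : 0 <= k * (r - 1) ^+ 2 by rewrite mulr_ge0 // sqr_ge0.
have h3 : 0 <= (1 - k) * (r - 1) ^+ 2 by rewrite mulr_ge0 ?sqr_ge0 //; lra.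
have h4 : 0 <= (1 - k) * (1 + k) * (1 + r) ^+ 2.
  by rewrite !mulr_ge0 ?sqr_ge0 //; lra.
apply: (@le_trans _ _ ((1 - k) / 2 * (1 + r) ^+ 2)); last nra.
nra.
Qed.

Lemma eexpB1_neq0 alpha x y : 0 < `|alpha * x| < 2 * pi -> eexp alpha x y - 1 != 0.
Proof.
move=> off; have [|c c0 /(_ x y)] := @eexpB1_lower alpha x x (lexx _).
  by move=> z /andP[z1 z2]; have -> : z = x by apply/eqP; rewrite eq_le z1 z2.
rewrite lexx => /(_ isT) h; apply/eqP => E; move: h; rewrite E Normc.normc0.
by apply/negP; rewrite -ltNge mulr_gt0 // addr_gt0 // expR_gt0.
Qed.

(** At one end of the line the kernel tends to -1, at the other it decays like e^{alpha y}; every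
    exponent between 0 and alpha dominates both behaviours. *)
Lemma kern_bound alpha beta a b : a <= b -> off_period alpha a b ->
  (0 <= beta <= alpha) || (alpha <= beta <= 0) ->
  exists2 C : R, 0 < C & forall x y, a <= x <= b ->
    normc (kern alpha x y) <= C * expR (beta * y).
Proof.
move=> ab off betaP; have [c c0 cP] := eexpB1_lower ab off.
exists c^-1; first by rewrite invr_gt0.
move=> x y xab; rewrite /kern Normc.normcV.
have e0 : 0 < 1 + expR (- alpha * y) by rewrite addr_gt0 // expR_gt0.
apply: (@le_trans _ _ (c * (1 + expR (- alpha * y)))^-1).
  rewrite lef_pV2 ?posrE ?cP // ?mulr_gt0 //.
  by apply: lt_le_trans (cP x y xab); rewrite mulr_gt0.
rewrite invfM ler_wpM2l // ?invr_ge0 ?(ltW c0) //.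
rewrite -[leLHS]mul1r ler_pdivrMr // mulrDr mulr1 -expRD.
have [h|h] := leP 0 (beta * y).
  by rewrite -[leLHS]addr0 lerD ?expR_ge0 // -[1](@expR0 R) ler_expR.
rewrite -[leLHS]add0r lerD ?expR_ge0 // -[1](@expR0 R) ler_expR.
rewrite -mulrDl; move: betaP => /orP[]/andP[h1 h2].
- have y0 : y <= 0 by case: (leP y 0) => // /ltW y0; have := mulr_ge0 h1 y0; lra.
  by rewrite mulr_le0 // subr_le0.
- have y0 : 0 <= y by case: (leP 0 y) => // /ltW y0; have := mulr_le0 h2 y0; lra.
  by rewrite mulr_ge0 // subr_ge0.
Qed.

Lemma kern_mul alpha x x' y y' :
  0 < `|alpha * x| < 2 * pi -> 0 < `|alpha * x'| < 2 * pi ->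
  0 < `|alpha * (x + x')| < 2 * pi ->
  kern alpha x y * kern alpha x' y' =
  kern alpha (x + x') (y + y') * (kern alpha x y + kern alpha x' y' + 1).
Proof.
move=> /(eexpB1_neq0 y) h1 /(eexpB1_neq0 y') h2 /(eexpB1_neq0 (y + y')).
rewrite /kern eexpD => h3; field.
by rewrite h1 h2 h3.
Qed.

End Kernel.

(** * Words as operators *)

Section Operators.
Variables (R : realType) (omega e : R).
Hypotheses (omega_gt0 : 0 < omega) (e01 : 0 < e < 1).
Notation Re := (@complex.Re R).
Notation Im := (@complex.Im R).
Notation normc := (@Normc.normc R).
Notation mu := (@lebesgue_measure R).
Notation MR := (measurableTypeR R).
Implicit Types (x y t : R) (w : seq bool) (K : R -> R[i]).

Definition Gfun x y : R[i] := hbarC omega * kern (- (2 * pi * omega)) x y.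

Definition Bop K y : R[i] :=
  'i%C * cintegral (fun t => kern (2 * pi) (- e) t * K (y + t)).

Arguments Bop : simpl never.

Lemma normc_Bop K y : normc (Bop K y) =
  normc (cintegral (fun t => kern (2 * pi) (- e) t * K (y + t))).
Proof. by rewrite /Bop Normc.normcM normc_i mul1r. Qed.

(* The operator of the word [w] (b is [true]) on functions of y, where T = x + i y;
   the letter b moves T from the line Re T = x to the line Re T = x - e. *)
Fixpoint Xop x w K : R -> R[i] :=
  match w with
  | [::] => K
  | true :: w' => Bop (Xop (x - e) w' K)
  | false :: w' => fun y => Gfun x y * Xop x w' K y
  end.

(** The bound 2 pi omega lets G itself carry the weight e^{- m y}; the bound pi gives 2 m <= 2 pi,
    so that the kernel of b overcomes the growth of this weight at -oo. *)
Definition decay : R := Num.min pi (2 * pi * omega).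

Lemma decay_gt0 : 0 < decay.
Proof. by rewrite lt_min pi_gt0 !mulr_gt0 // pi_gt0. Qed.

Let m := decay.
Let m_gt0 : 0 < m. Proof. exact: decay_gt0. Qed.

Definition wt t : R := expR (- m * `|t|).

Let wt_ge0 t : 0 <= wt t. Proof. exact: expR_ge0. Qed.

Lemma integrable_wt (c : R) : mu.-integrable setT (EFin \o (fun t => c * wt t)).
Proof.
rewrite (_ : EFin \o _ = fun t => (c%:E * (EFin \o wt) t)%E) //.
by apply: integrableZl => //; exact: integrable_expR_abs.
Qed.

Let expR_split y t : expR (- m * (y + t)) = expR (- m * y) * expR (- m * t).
Proof. by rewrite -expRD mulrDr. Qed.

Lemma kern_weight : exists2 C : R, 0 < C & forall t,
  normc (kern (2 * pi) (- e) t) * expR (- m * t) <= C * wt t.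
Proof.
have p0 := pi_gt0 R.
have off : off_period (2 * pi) (- e) (- e).
  move=> x /andP[x1 x2]; have -> : x = - e by apply/eqP; rewrite eq_le x1 x2.
  rewrite mulrN normrN ger0_norm; last by move/andP: e01 => [e0 _]; rewrite !mulr_ge0 // ltW.
  move/andP: e01 => [e0 e1]; rewrite !mulr_gt0 //=.
  by rewrite -[ltRHS]mulr1 ltr_pM2l // mulr_gt0.
have mpi : m <= pi by rewrite ge_min lexx.
(* Exponent 0 serves t >= 0. Exponent 2 m serves t < 0, where it leaves e^{m t} after multiplication
   by e^{- m t}. *)
have [|C0 C00 h0] := @kern_bound R (2 * pi) 0 _ _ (lexx _) off.
  by rewrite lexx mulr_ge0 // pi_ge0.
have [|C1 C10 h1] := @kern_bound R (2 * pi) (2 * m) _ _ (lexx _) off.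
  by apply/orP; left; rewrite ler_pM2l // mpi andbT mulr_ge0 // ltW.
exists (C0 + C1); first exact: addr_gt0.
move=> t; rewrite /wt; case: (leP 0 t) => t0.
  rewrite (ger0_norm t0) ler_wpM2r ?expR_ge0 //; apply: le_trans (h0 (- e) t _) _; first by rewrite lexx.
  by rewrite mul0r expR0 mulr1 lerDl ltW.
rewrite (ltr0_norm t0).
apply: (@le_trans _ _ (C1 * expR (2 * m * t) * expR (- m * t))).
  by rewrite ler_wpM2r ?expR_ge0 //; apply: h1; rewrite lexx.
rewrite -mulrA -expRD.
have -> : 2 * m * t + - m * t = - m * - t by ring.
by rewrite ler_wpM2r ?expR_ge0 // lerDr ltW.
Qed.

(** Every letter a is read on a line with -1/omega < Re T < 0, between two poles of G. *)
Fixpoint valid x w : bool :=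
  match w with
  | [::] => true
  | true :: w' => valid (x - e) w'
  | false :: w' => (x < 0) && (-1 < omega * x) && valid x w'
  end.

(** Lines only move to the left, so the leftmost one decides the lower bound. The condition on the
    first letter excludes the pole of G at T = 0. *)
Lemma valid_count x w : x <= 0 -> (x < 0) || head true w ->
  -1 < omega * (x - (count id w)%:R * e) -> valid x w.
Proof.
have := omega_gt0; have /andP[e0 _] := e01; move=> o0.
elim: w x => [|[] w IH] x x0 xw //= h.
- apply: IH; [lra|apply/orP; left; lra|].
  by move: h; rewrite add1n -natr1; congr (_ < _ * _); ring.
- rewrite orbF in xw; rewrite xw IH ?xw // andbT /=.
  apply: lt_le_trans h _; rewrite ler_pM2l //.
  by rewrite lerBlDr lerDl mulr_ge0 // ltW.
Qed.

Lemma off_period_G x : x < 0 -> -1 < omega * x -> 0 < `|- (2 * pi * omega) * x| < 2 * pi.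
Proof.
move=> x0 ox; have p0 := pi_gt0 R; have h : omega * x < 0 by rewrite pmulr_rlt0.
have -> : - (2 * pi * omega) * x = (2 * pi) * (- (omega * x)) by ring.
rewrite ger0_norm; last by rewrite !mulr_ge0 //; lra.
apply/andP; split; first by rewrite !mulr_gt0 //; lra.
by rewrite -[ltRHS]mulr1 ltr_pM2l; lra.
Qed.

Lemma Gfun_bound beta x : x < 0 -> -1 < omega * x -> - (2 * pi * omega) <= beta <= 0 ->
  exists2 C : R, 0 <= C & forall y, normc (Gfun x y) <= C * expR (beta * y).
Proof.
move=> x0 ox hb; have off := off_period_G x0 ox.
have offx : off_period (- (2 * pi * omega)) x x.
  by move=> z /andP[z1 z2]; have -> : z = x by apply/eqP; rewrite eq_le z1 z2.
have [|C C0 h] := @kern_bound R _ beta x x (lexx _) offx; first by rewrite hb orbT.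
exists (normc (hbarC omega) * C); first by rewrite mulr_ge0 ?normc_ge0 // ltW.
by move=> y; rewrite /Gfun Normc.normcM -[leRHS]mulrA ler_wpM2l ?normc_ge0 // h // lexx.
Qed.

Lemma Bop_kernel_bound (C : R) K y : (forall z, normc (K z) <= C * expR (- m * z)) ->
  0 <= C ->
  exists2 D : R, 0 <= D & forall t,
   normc (kern (2 * pi) (- e) t * K (y + t)) <= D * wt t.
Proof.
move=> hK C0; have [Ck Ck0 hk] := kern_weight.
exists (C * expR (- m * y) * Ck); first by rewrite !mulr_ge0 ?expR_ge0 // ltW.
move=> t; rewrite Normc.normcM.
apply: (@le_trans _ _ (normc (kern (2 * pi) (- e) t) * (C * expR (- m * (y + t))))).
  by rewrite ler_wpM2l ?normc_ge0.
rewrite expR_split -[leRHS]mulrA.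
have -> : normc (kern (2 * pi) (- e) t) * (C * (expR (- m * y) * expR (- m * t))) =
  C * expR (- m * y) * (normc (kern (2 * pi) (- e) t) * expR (- m * t)) by ring.
by rewrite ler_wpM2l // mulr_ge0 ?expR_ge0.
Qed.

(** * Bounds uniform in a parameter *)

Section Good.
Context d (T : measurableType d).
Implicit Types (H : T * MR -> R[i]) (W : T -> R).

(** Fubini needs a majorant that is a product in the two variables; a bound for each fixed [s] with
    an unspecified constant would not do. *)
Definition good2 H W := cmeasurable H /\
  exists2 C : R, 0 <= C & forall s y, normc (H (s, y)) <= C * W s * expR (- m * y).

Lemma good2_section H W s : good2 H W -> @cmeasurable R _ MR (fun y => H (s, y)).
Proof.
by move=> [mH _]; exact: (cmeasurable_pair2 s mH).
Qed.

Lemma good2_Bop H W : (forall s, 0 <= W s) -> good2 H W ->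
  good2 (fun p => Bop (fun y => H (p.1, y)) p.2) W.
Proof.
move=> W0 gH; have [mH [C C0 hC]] := gH; have [Ck Ck0 hk] := kern_weight; split.
  rewrite /Bop; apply: cmeasurableM; first exact: cmeasurable_cst.
  apply: (@cmeasurable_cintegral R _ (T * MR)%type
    (fun q : (T * MR) * MR => kern (2 * pi) (- e) q.2 * H (q.1.1, q.1.2 + q.2))).
  apply: cmeasurableM.
    exact: (cmeasurable_comp (h := snd) measurable_snd (cmeasurable_kern _ _)).
  apply: (cmeasurable_comp (h := fun q : (T * MR) * MR => (q.1.1, (q.1.2 + q.2 : MR))) _ mH).
  apply: measurable_fun_pair.
    exact: (measurableT_comp measurable_fst measurable_fst).
  apply: (@measurable_funD _ _ R setT (fun q : (T * MR) * MR => q.1.2) (fun q => q.2)).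
    exact: (measurableT_comp measurable_snd measurable_fst).
  exact: measurable_snd.
exists (2 * (Rintegral mu setT wt) * Ck * C).
  by rewrite !mulr_ge0 ?(ltW Ck0) // Rintegral_ge0.
move=> s y; rewrite -[(s, y).1]/s -[(s, y).2]/y normc_Bop.
apply: le_trans (normc_cintegral_le (w := fun t => (C * W s * expR (- m * y) * Ck) * wt t) _ _ _) _.
- exact: integrable_wt.
- apply: cmeasurableM; first exact: cmeasurable_kern.
  exact: (cmeasurable_shift y (good2_section s gH)).
- move=> t; rewrite Normc.normcM.
  apply: (@le_trans _ _ (normc (kern (2 * pi) (- e) t) * (C * W s * expR (- m * (y + t))))).
    by rewrite ler_wpM2l ?normc_ge0.
  rewrite expR_split -[leRHS]mulrA.
  have -> : normc (kern (2 * pi) (- e) t) * (C * W s * (expR (- m * y) * expR (- m * t))) =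
    C * W s * expR (- m * y) * (normc (kern (2 * pi) (- e) t) * expR (- m * t)) by ring.
  by rewrite ler_wpM2l // !mulr_ge0 ?expR_ge0.
rewrite RintegralZl //; last exact: integrable_expR_abs.
by rewrite le_eqVlt; apply/orP; left; apply/eqP; ring.
Qed.

Lemma good2_Gfun x H W : (forall s, 0 <= W s) -> x < 0 -> -1 < omega * x -> good2 H W ->
  good2 (fun p => Gfun x p.2 * H p) W.
Proof.
move=> W0 x0 ox [mH [C C0 hC]]; split.
  apply: cmeasurableM => //; apply: cmeasurableM; first exact: cmeasurable_cst.
  exact: (cmeasurable_comp (h := snd) measurable_snd (cmeasurable_kern _ _)).
have [|D D0 hD] := @Gfun_bound 0 x x0 ox.
  by rewrite lexx oppr_le0 !mulr_ge0 ?pi_ge0 ?(ltW omega_gt0).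
exists (D * C); first exact: mulr_ge0.
move=> s y; rewrite Normc.normcM -!mulrA ler_pM ?normc_ge0 //.
  by have := hD y; rewrite mul0r expR0 mulr1.
by rewrite mulrA hC.
Qed.

Lemma good2_Xop x w H W : (forall s, 0 <= W s) -> valid x w -> good2 H W ->
  good2 (fun p => Xop x w (fun y => H (p.1, y)) p.2) W.
Proof.
move=> W0; elim: w x => [|[] w IH] x /=.
- move=> _ gH; rewrite (_ : (fun p => H (p.1, p.2)) = H) //.
  by apply/funext => -[].
- move=> v gH; exact: (good2_Bop W0 (IH _ v gH)).
- move=> /andP[/andP[x0 ox] v] gH.
  exact: (good2_Gfun W0 x0 ox (IH _ v gH)).
Qed.

End Good.

(* The weight grows as y -> -oo because a bounded one is not preserved by [Bop]: the
   integral of min(1, e^{2 pi t}) min(1, e^{- m (y + t)}) grows linearly. *)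
Definition good K := @cmeasurable R _ MR K /\
  exists2 C : R, 0 <= C & forall y, normc (K y) <= C * expR (- m * y).

Lemma good_good2 K : good K -> @good2 _ MR (fun p => K p.2) (fun _ => 1).
Proof.
move=> [mK [C C0 hC]]; split.
  exact: (cmeasurable_comp (h := snd) measurable_snd mK).
by exists C => // s y; rewrite mulr1.
Qed.

Lemma good2_good d (T : measurableType d) (H : T * MR -> R[i]) (W : T -> R) s :
  0 <= W s -> good2 H W -> good (fun y => H (s, y)).
Proof.
move=> W0 gH; split; first exact: good2_section gH.
by have [_ [C C0 hC]] := gH; exists (C * W s); [exact: mulr_ge0|].
Qed.

Lemma good_Xop x w K : valid x w -> good K -> good (Xop x w K).
Proof.
move=> v /good_good2 gK.
have G := good2_Xop (fun _ => ler01) v gK.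
exact: (good2_good (s := (0 : MR)) ler01 G).
Qed.

Lemma good_Bop K : good K -> good (Bop K).
Proof. by move=> gK; exact: (@good_Xop 0 [:: true] K). Qed.

Lemma good_Gfun_mul x K : x < 0 -> -1 < omega * x -> good K -> good (fun y => Gfun x y * K y).
Proof. by move=> x0 ox gK; apply: (@good_Xop x [:: false] K) => //=; rewrite x0 ox. Qed.

Lemma goodD K K' : good K -> good K' -> good (fun y => K y + K' y).
Proof.
move=> [mK [C C0 hC]] [mK' [C' C0' hC']]; split; first exact: cmeasurableD.
exists (C + C') => [|y]; first exact: addr_ge0.
by rewrite mulrDl; apply: le_trans (le_normcD _ _) _; apply: lerD.
Qed.

Lemma goodZ (c : R[i]) K : good K -> good (fun y => c * K y).
Proof.
move=> [mK [C C0 hC]]; split; first by apply: cmeasurableM => //; exact: cmeasurable_cst.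
exists (normc c * C) => [|y]; first by rewrite mulr_ge0 ?normc_ge0.
by rewrite Normc.normcM -mulrA ler_wpM2l ?normc_ge0.
Qed.

(** Here G supplies the decay itself, with exponent - m, whereas as a factor of a good function it
    is only used as a bounded one. *)
Lemma good_Gfun x : x < 0 -> -1 < omega * x -> good (Gfun x).
Proof.
move=> x0 ox; split.
  by apply: cmeasurableM; [exact: cmeasurable_cst|exact: cmeasurable_kern].
apply: Gfun_bound => //; rewrite lerN2 ge_min lexx orbT /=.
by rewrite oppr_le0 ltW.
Qed.

Lemma cintegrable_Bop K y : good K ->
  cintegrable (fun t => kern (2 * pi) (- e) t * K (y + t)).
Proof.
move=> [mK [C C0 hC]]; have [D D0 hD] := Bop_kernel_bound y hC C0.
apply: (cintegrable_dom (integrable_wt D)) => //.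
apply: cmeasurableM; first exact: cmeasurable_kern.
exact: (cmeasurable_shift y mK).
Qed.

Lemma XopD x w K K' : valid x w -> good K -> good K' ->
  Xop x w (fun y => K y + K' y) = fun y => Xop x w K y + Xop x w K' y.
Proof.
elim: w x => [|[] w IH] x //=.
- move=> v gK gK'; rewrite (IH _ v gK gK'); apply/funext => y; rewrite /Bop -mulrDr.
  rewrite -cintegralD; try (by apply: cintegrable_Bop; exact: good_Xop).
  by congr (_ * cintegral _); apply/funext => t; rewrite mulrDr.
- move=> /andP[_ v] gK gK'; rewrite (IH _ v gK gK'); apply/funext => y.
  by rewrite mulrDr.
Qed.

Lemma XopZ x w (c : R[i]) K : valid x w -> good K ->
  Xop x w (fun y => c * K y) = fun y => c * Xop x w K y.
Proof.
elim: w x => [|[] w IH] x //=.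
- move=> v gK; rewrite (IH _ v gK); apply/funext => y; rewrite /Bop mulrCA.
  rewrite -[in RHS]cintegralZ; last by apply: cintegrable_Bop; exact: good_Xop.
  by congr (_ * cintegral _); apply/funext => t; rewrite mulrCA.
- move=> /andP[_ v] gK; rewrite (IH _ v gK); apply/funext => y.
  by rewrite mulrCA.
Qed.

Lemma Xop_rcons_b x w K : Xop x (rcons w true) K = Xop x w (Bop K).
Proof. by elim: w x => [|[] w IH] x //=; rewrite IH. Qed.

Lemma Xop_rcons_a x w K : Xop x (rcons w false) K =
  Xop x w (fun y => Gfun (x - (count id w)%:R * e) y * K y).
Proof.
elim: w x => [|[] w IH] x /=; first by rewrite mul0r subr0.
- have -> : x - (1 + count id w)%:R * e = x - e - (count id w)%:R * e.
    by rewrite natrD; ring.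
  by rewrite IH.
- by rewrite IH.
Qed.

(** This carries an integration in one variable past a whole word in the other. By induction on [w],
    a letter a is a factor independent of [s], and a letter b is one exchange of integrals,
    dominated by wt(s) wt(t) up to a constant. *)
Lemma Bop_Xop_comm x w (H : MR * MR -> R[i]) y : valid x w ->
  good2 H (fun s : MR => expR (- m * s)) ->
  cintegral (fun s => kern (2 * pi) (- e) s * Xop x w (fun z => H (s, z)) y) =
  Xop x w (fun z => cintegral (fun s => kern (2 * pi) (- e) s * H (s, z))) y.
Proof.
move=> + gH; have W0 (s : MR) : 0 <= expR (- m * s) by exact: expR_ge0.
have [Ck Ck0 hk] := kern_weight.
have int x' w' z : valid x' w' ->
    cintegrable (fun s => kern (2 * pi) (- e) s * Xop x' w' (fun z => H (s, z)) z).
  move=> v; have [mX [C C0 hC]] := good2_Xop W0 v gH.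
  apply: (cintegrable_dom (integrable_wt (C * expR (- m * z) * Ck))).
    apply: cmeasurableM; first exact: cmeasurable_kern.
    exact: (cmeasurable_pair1 (z : MR) mX).
  move=> s; rewrite Normc.normcM.
  apply: le_trans (ler_wpM2l (normc_ge0 _) (hC s z)) _.
  have -> : normc (kern (2 * pi) (- e) s) * (C * expR (- m * s) * expR (- m * z)) =
    C * expR (- m * z) * (normc (kern (2 * pi) (- e) s) * expR (- m * s)) by ring.
  by rewrite -[leRHS]mulrA ler_wpM2l // mulr_ge0 ?expR_ge0.
elim: w x y => [|[] w IH] x y //=.
- move=> v; rewrite {1}/Bop.
  have [mX [C C0 hC]] := good2_Xop W0 v gH.
  pose F (p : MR * MR) := kern (2 * pi) (- e) p.1 * (kern (2 * pi) (- e) p.2 *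
      Xop (x - e) w (fun z => H (p.1, z)) (y + p.2)).
  have mF : cmeasurable F.
    apply: cmeasurableM; first exact: (cmeasurable_comp (h := fst) measurable_fst (cmeasurable_kern _ _)).
    apply: cmeasurableM; first exact: (cmeasurable_comp (h := snd) measurable_snd (cmeasurable_kern _ _)).
    apply: (cmeasurable_comp (h := fun p : MR * MR => (p.1, (y + p.2 : MR))) _ mX).
    apply: measurable_fun_pair; first exact: measurable_fst.
    apply: (@measurable_funD _ _ R setT (fun _ : MR * MR => y) (fun q => q.2)).
      exact: measurable_cst.
    exact: measurable_snd.
  have hF s t : normc (F (s, t)) <= (C * expR (- m * y) * Ck * wt s) * (Ck * wt t).
    rewrite /F /= !Normc.normcM.
    apply: (@le_trans _ _ (normc (kern (2 * pi) (- e) s) * (normc (kern (2 * pi) (- e) t) *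
       (C * expR (- m * s) * expR (- m * (y + t)))))).
      by rewrite !ler_wpM2l ?normc_ge0 //; exact: hC.
    rewrite expR_split.
    have -> : normc (kern (2 * pi) (- e) s) * (normc (kern (2 * pi) (- e) t) *
       (C * expR (- m * s) * (expR (- m * y) * expR (- m * t)))) =
       (C * expR (- m * y)) * (normc (kern (2 * pi) (- e) s) * expR (- m * s)) *
        (normc (kern (2 * pi) (- e) t) * expR (- m * t)) by ring.
    rewrite ler_pM ?mulr_ge0 ?normc_ge0 ?expR_ge0 //.
    by rewrite -[leRHS]mulrA ler_wpM2l // mulr_ge0 ?expR_ge0.
  have sw := @cintegral_swap R F _ _ (integrable_wt _) (integrable_wt _)
    (fun s => mulr_ge0 (mulr_ge0 (mulr_ge0 C0 (expR_ge0 _)) (ltW Ck0)) (wt_ge0 s))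
    (fun t => mulr_ge0 (ltW Ck0) (wt_ge0 t)) mF hF.
  transitivity ('i%C * cintegral (fun s => cintegral (fun t => F (s, t)))).
    have iS : cintegrable (fun s => cintegral (fun t => F (s, t))).
      exact: (cintegrable_cintegral (integrable_wt _) (integrable_wt _) mF hF).
    rewrite -(cintegralZ 'i%C iS); congr (cintegral _); apply/funext => s.
    have iB := cintegrable_Bop y (good2_good (s := s) (W0 s) (good2_Xop W0 v gH)).
    by rewrite mulrCA -(cintegralZ (kern (2 * pi) (- e) s) iB).
  rewrite sw.
  congr (_ * cintegral _); apply/funext => t; rewrite -(IH _ _ v).
  rewrite -(cintegralZ _ (int _ _ _ v)).
  by congr (cintegral _); apply/funext => s; rewrite /F mulrCA.
- move=> /andP[_ v]; rewrite -(IH _ _ v) -(cintegralZ _ (int _ _ _ v)).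
  by congr (cintegral _); apply/funext => s; rewrite mulrCA.
Qed.

Lemma Gfun_mul x x' y y' : x < 0 -> x' < 0 -> -1 < omega * (x + x') ->
  Gfun x y * Gfun x' y' =
  Gfun (x + x') (y + y') * (Gfun x y + Gfun x' y' + hbarC omega).
Proof.
have o0 := omega_gt0; move=> x0 x0' h.
have h1 : omega * x < 0 by rewrite pmulr_rlt0.
have h2 : omega * x' < 0 by rewrite pmulr_rlt0.
rewrite /Gfun mulrACA kern_mul; try (apply: off_period_G; lra).
by ring.
Qed.

End Operators.

(** * The terms of a shuffle *)

(* The terms hbar^n * word of a shuffle of two reversed words, as pairs of n and the
   reversed word. *)
Fixpoint shl (u : seq bool) : seq bool -> seq (nat * seq bool) :=
  match u with
  | [::] => fun v => [:: (0%N, v)]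
  | x :: u' => fix aux (v : seq bool) : seq (nat * seq bool) :=
      match v with
      | [::] => [:: (0%N, u)]
      | y :: v' =>
          if x then [seq (q.1, true :: q.2) | q <- shl u' v]
          else if y then [seq (q.1, true :: q.2) | q <- aux v']
          else [seq (q.1, false :: q.2) | q <- aux v' ++ shl u' v] ++
               [seq (q.1.+1, false :: q.2) | q <- shl u' v']
      end
  end.

Lemma shl_nilr u : shl u [::] = [:: (0%N, u)].
Proof. by case: u. Qed.

Lemma shl_br u v : shl (false :: u) (true :: v) =
  [seq (q.1, true :: q.2) | q <- shl (false :: u) v].
Proof. by []. Qed.

Lemma shl_bl u v : v != [::] ->
  shl (true :: u) v = [seq (q.1, true :: q.2) | q <- shl u v].
Proof. by case: v. Qed.

Lemma shl_aa u v : shl (false :: u) (false :: v) =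
  [seq (q.1, false :: q.2) | q <- shl (false :: u) v ++ shl u (false :: v)] ++
  [seq (q.1.+1, false :: q.2) | q <- shl u v].
Proof. by []. Qed.

(** The recursion scheme of [shl]. A b on the left is removed first, so the right one is only
    removed when the left word ends in a. *)
Lemma shl_ind (P : seq bool -> seq bool -> Prop) :
  (forall v, P [::] v) -> (forall u, P u [::]) ->
  (forall u v, v != [::] -> P u v -> P (true :: u) v) ->
  (forall u v, P (false :: u) v -> P (false :: u) (true :: v)) ->
  (forall u v, P (false :: u) v -> P u (false :: v) -> P u v ->
     P (false :: u) (false :: v)) ->
  forall u v, P u v.
Proof.
move=> P0 P1 Pbl Pbr Paa; elim=> [|x u IHu] v; first exact: P0.
case: x; first by case: v => [|y v]; [exact: P1|exact: Pbl].
by elim: v => [|[] v IHv]; [exact: P1|exact: Pbr|exact: Paa].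
Qed.

(** All terms contain the same number of integrations, so their last letters are read on one common
    line; this lets a last a be absorbed into K for all terms at once. *)
Lemma count_shl u v q : q \in shl u v -> count id q.2 = (count id u + count id v)%N.
Proof.
move: u v q; apply: shl_ind => [v|u|u v v0 IH|u v IH|u v IH1 IH2 IH3] q.
- by rewrite inE => /eqP ->.
- by rewrite shl_nilr inE => /eqP ->; rewrite addn0.
- by rewrite shl_bl // => /mapP[q' /IH h ->] /=; rewrite h; lia.
- by rewrite shl_br => /mapP[q' /IH h ->] /=; rewrite h /=; lia.
- rewrite shl_aa map_cat !mem_cat -orbA => /or3P[] /mapP[q' + ->] /=.
  + by move=> /IH1.
  + by move=> /IH2.
  + by move=> /IH3.
Qed.

Lemma shuffle_revE u v :
  shuffle_rev u v = \sum_(q <- shl u v) hbar ^+ q.1 *: word (rev q.2).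
Proof.
have wb (r : seq bool) x : word (rev r) * word [:: x] = word (rev (x :: r)).
  by rewrite word_cat rev_cons -cats1.
have app (s : seq (nat * seq bool)) x :
    (\sum_(q <- s) hbar ^+ q.1 *: word (rev q.2)) * word [:: x] =
    \sum_(q <- [seq (q.1, x :: q.2) | q <- s]) hbar ^+ q.1 *: word (rev q.2).
  by rewrite big_map mulr_suml; apply: eq_bigr => q _ /=; rewrite -scalerAl wb.
move: u v; apply: shl_ind => [v|u|u v v0 IH|u v IH|u v IH1 IH2 IH3].
- by rewrite big_seq1 expr0 scale1r.
- by rewrite shl_nilr big_seq1 expr0 scale1r; case: u.
- by rewrite shl_bl // -app -IH; case: v v0 {IH}.
- by rewrite shl_br -app -IH.
- rewrite shl_aa big_cat -app big_cat big_map /= -IH1 -IH2.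
  rewrite -[LHS]/((shuffle_rev (false :: u) v + shuffle_rev u (false :: v) +
    hbar *: shuffle_rev u v) * word [:: false]).
  rewrite mulrDl; congr (_ + _); rewrite -scalerAl IH3 app big_map scaler_sumr.
  by apply: eq_bigr => q _; rewrite scalerA -exprS.
Qed.

(* [zero_count u] is the number of letters e_1 - g_1 needed to write the reversed word
   [u] in the alphabet A, and [bb_count u] the number needed for this word followed by
   a. *)
Fixpoint bb_count (u : seq bool) : nat :=
  if u is x :: u' then (bb_count u' + (x && head false u'))%N else 0%N.

Definition zero_count (u : seq bool) : nat := (bb_count u + head false u)%N.

(* The first bound says that the module spanned by the monomials is closed under the
   shuffle product; it is not inductive alone, as removing a final a from b a creates a
   letter e_1 - g_1. *)
Lemma shl_counts u v q : q \in shl u v ->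
  (zero_count q.2 <= zero_count u + zero_count v + q.1)%N /\
  (bb_count q.2 <= bb_count u + bb_count v + q.1 + head false u * head false v)%N.
Proof.
rewrite /zero_count; move: u v q.
apply: shl_ind => [v|u|u v v0 IH|u v IH|u v IH1 IH2 IH3] q.
- by rewrite inE => /eqP -> /=; lia.
- by rewrite shl_nilr inE => /eqP -> /=; lia.
(* Since [bb_count (true :: r)] is [zero_count r], the second bound comes here from the first one of
   the induction hypothesis. For two letters a it is the second one that yields both. *)
- by rewrite shl_bl // => /mapP[q' /IH [h _] ->] /=; move: h;
    case: (head false q'.2) (head false u) (head false v) => [] [] [] /=;
    rewrite ?mul1n => h; split; lia.
- by rewrite shl_br => /mapP[q' /IH [/= h _] ->] /=; rewrite mul0n; split; lia.
- rewrite shl_aa map_cat !mem_cat -orbA => /or3P[] /mapP[q' + ->] /=.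
  + by move=> /IH1 [_ /= h]; lia.
  + by move=> /IH2 [_ /= h]; lia.
  + by move=> /IH3 [_ /= h]; case: (head false u) (head false v) h => [] [] /=; lia.
Qed.

(** In reversed form, [last true] says that the word is empty or begins with b, which is what makes
    it decodable by [parse]. Putting an a at the end preserves this for nonempty words, and
    [count_shl] gives nonemptiness. *)
Lemma last_shl u v q : last true u -> last true v -> q \in shl u v -> last true q.2.
Proof.
move: u v q; apply: shl_ind => [v|u|u v v0 IH|u v IH|u v IH1 IH2 IH3] q lu lv.
- by rewrite inE => /eqP ->.
- by rewrite shl_nilr inE => /eqP ->.
- by rewrite shl_bl // => /mapP[q' /IH h ->] /=; exact: h.
- by rewrite shl_br => /mapP[q' /IH h ->] /=; exact: h.
- have ne (r : seq bool) : last true (false :: r) -> last true r by case: r.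
  have ln (r : seq bool) : last true (false :: r) -> count id r != 0%N.
    case/lastP: r => // r x; rewrite -[last _ _]/(last false (rcons r x)) last_rcons => xT.
    by rewrite -cats1 count_cat /= xT; lia.
  have fin (r : seq bool) : count id r != 0%N -> last true r -> last true (false :: r).
    by case: r.
  rewrite shl_aa map_cat !mem_cat -orbA => /or3P[] /mapP[q' qin ->].
  + apply: fin; last exact: IH1 lu (ne _ lv) qin.
    by rewrite (count_shl qin) addn_eq0 negb_and ln.
  + apply: fin; last exact: IH2 (ne _ lu) lv qin.
    by rewrite (count_shl qin) addn_eq0 negb_and ln.
  + apply: fin; last exact: IH3 (ne _ lu) (ne _ lv) qin.
    by rewrite (count_shl qin) addn_eq0 negb_and ln.
Qed.

Lemma head_shl_aa u v q : q \in shl (false :: u) (false :: v) -> head true q.2 = false.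
Proof.
by rewrite shl_aa map_cat !mem_cat -orbA => /or3P[] /mapP[q' _ ->].
Qed.

Definition rparse (u : seq bool) : seq nat := foldr (fun x acc => parse_step acc x) [::] u.

Lemma parse_rev u : Defs.parse (rev u) = rev (rparse u).
Proof. by rewrite /Defs.parse foldl_rev. Qed.

Lemma rparse_nonnil u : last false u -> rparse u != [::].
Proof. by elim: u => [|[] u IH] //= /IH; case: (rparse u). Qed.

Lemma spell_rcons s k : spell (rcons s k) = spell s ++ true :: nseq k false.
Proof. by rewrite /spell map_rcons flatten_rcons. Qed.

Lemma rparseP u : last true u ->
  [/\ spell (rev (rparse u)) = rev u,
      count_mem 0%N (rparse u) = zero_count u &
      head false u = (head 1%N (rparse u) == 0%N)].
Proof.
elim: u => [|[] u IH] //.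
- move=> lu; have {}IH : _ := IH lu; case: IH => h1 h2 h3; split.
  + by rewrite /= rev_cons spell_rcons h1 rev_cons -cats1.
  + by rewrite /= h2 /zero_count /=; lia.
  + by [].
- move=> lu; have lu' : last true u by case: u lu {IH}.
  have := rparse_nonnil lu; case: (IH lu').
  rewrite /zero_count /=; case: (rparse u) => [|k r] //= h1 h2 h3 _; split => //.
  + move: h1; rewrite !rev_cons !spell_rcons => <-.
    rewrite -cats1 -catA /=; congr (_ ++ _ :: _).
    by rewrite -[false :: nseq k _]/(nseq k.+1 false) -addn1 nseqD.
  + by rewrite h3 in h2; case: eqP h2 => _ /=; lia.
Qed.

Lemma last_rev_spell s : last true (rev (spell s)).
Proof.
by case: s => [|k s] //; rewrite /spell /= rev_cons last_rcons.
Qed.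

Lemma count_spell s : count id (spell s) = size s.
Proof.
elim: s => [|k s IH] //; rewrite /spell /= count_cat IH /=.
by rewrite count_nseq mul0n add0n.
Qed.

Lemma zero_count_spell s : zero_count (rev (spell s)) = count_mem 0%N s.
Proof.
have [_ <- _] := rparseP (last_rev_spell s).
by rewrite -count_rev -parse_rev revK spellK.
Qed.

Lemma spell_admissible s : s != [::] -> admissible s ->
  exists u, rev (spell s) = false :: u.
Proof.
case/lastP: s => // s k _; rewrite /admissible last_rcons spell_rcons.
case: k => // k _; exists (rev (spell s ++ true :: nseq k false)).
rewrite -[RHS]rev_rcons -cats1 -catA /=.
by rewrite -[false :: nseq k _]/(nseq k.+1 false) -addn1 nseqD.
Qed.

Lemma shuffleZl (c : {poly rat}) (x y : frakH) : shuffle (c *: x) y = c *: shuffle x y.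
Proof.
have aH (z : frakH) : z + 0 = z by exact: addr0.
have E : shuffle (c *: x) y = shuffle (c *: x + 0) y.
  by congr (shuffle _ _); exact: esym (aH _).
apply: (etrans E); apply: (etrans (shuffle_linearl c x 0 y)).
by apply: (etrans _ (aH _)); congr (_ + _); exact: shuffle0l.
Qed.

Lemma shuffleZr (c : {poly rat}) (x y : frakH) : shuffle x (c *: y) = c *: shuffle x y.
Proof.
have aH (z : frakH) : z + 0 = z by exact: addr0.
have E : shuffle x (c *: y) = shuffle x (c *: y + 0).
  by congr (shuffle _ _); exact: esym (aH _).
apply: (etrans E); apply: (etrans (shuffle_linearr c x y 0)).
by apply: (etrans _ (aH _)); congr (_ + _); exact: shuffle0r.
Qed.

Lemma shuffle_monomial s t :
  shuffle (monomial s) (monomial t) =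
  \sum_(q <- shl (rev (spell s)) (rev (spell t)))
    hbar ^+ (count_mem 0%N s + count_mem 0%N t + q.1 - zero_count q.2) *:
      monomial (Defs.parse (rev q.2)).
Proof.
rewrite (monomialE s) (monomialE t) shuffleZl shuffleZr shuffle_word shuffle_revE scalerA scaler_sumr.
apply: eq_big_seq => q qin; rewrite scalerA -!exprD monomialE.
have lq := last_shl (last_rev_spell s) (last_rev_spell t) qin.
have [h1 h2 _] := rparseP lq.
rewrite parse_rev count_rev h2 h1 scalerA -exprD.
(* The subtraction in the exponent is truncated; this inequality shows that nothing is cut off. *)
have [+ _] := shl_counts qin; rewrite !zero_count_spell => le.
by rewrite subnK.
Qed.

(** * Operators and the shuffle product *)

Section ShuffleOperators.
Variables (R : realType) (omega e : R).
Hypotheses (omega_gt0 : 0 < omega) (e01 : 0 < e < 1).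
Notation MR := (measurableTypeR R).
Notation Xop := (Xop omega e).
Notation Gfun := (Gfun omega).
Notation good := (good omega).
Notation m := (decay omega).
Implicit Types (x y : R) (u v : seq bool) (K : R -> R[i]).

(* The words [rev u] and [rev v] act on K(T + T') in T and T' respectively. *)
Definition Xop2 u v K : R[i] :=
  Xop 0 (rev u) (fun y => Xop 0 (rev v) (fun y' => K (y + y')) 0) 0.

(** The letters b of both words are counted together because the partial fraction evaluates G at T +
    T'. *)
Definition in_range u v := -1 < omega * (0 - (count id u + count id v)%:R * e).

Lemma good_shift y K : good K -> good (fun z => K (y + z)).
Proof.
move=> [mK [C C0 hC]]; split; first exact: (cmeasurable_shift y mK).
exists (C * expR (- m * y)) => [|z]; first by rewrite mulr_ge0 ?expR_ge0.
by rewrite -mulrA -expRD -mulrDr.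
Qed.

Lemma good2_add K : good K ->
  @good2 _ omega _ MR (fun p => K (p.1 + p.2)) (fun s => expR (- m * s)).
Proof.
move=> [mK [C C0 hC]]; split.
  apply: (cmeasurable_comp (h := fun p : MR * MR => (p.1 + p.2 : MR)) _ mK).
  apply: (@measurable_funD _ _ R setT (fun p : MR * MR => p.1) (fun p => p.2)).
    exact: measurable_fst.
  exact: measurable_snd.
by exists C => // s y; rewrite -mulrA -expRD -mulrDr.
Qed.

Lemma good_pair1 (H : MR * MR -> R[i]) y :
  @good2 _ omega _ MR H (fun s => expR (- m * s)) -> good (fun s => H (s, y)).
Proof.
move=> [mH [C C0 hC]]; split; first exact: (cmeasurable_pair1 (y : MR) mH).
exists (C * expR (- m * y)) => [|s]; first by rewrite mulr_ge0 ?expR_ge0.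
by rewrite mulrAC; exact: hC.
Qed.

Let W0 (s : MR) : 0 <= expR (- m * s). Proof. exact: expR_ge0. Qed.

Lemma good_inner x w K : valid omega e x w -> good K ->
  good (fun y => Xop x w (fun y' => K (y + y')) 0).
Proof.
move=> v gK; have G := good2_Xop omega_gt0 e01 W0 v (good2_add gK).
exact: (good_pair1 0 G).
Qed.

Lemma valid_rev u v : last true u -> in_range u v -> valid omega e 0 (rev u).
Proof.
have := omega_gt0; have /andP[e0 _] := e01; move=> o0.
move=> lu h; apply: valid_count => //.
  case/lastP: u lu {h} => [|u b]; first by rewrite ltxx.
  by rewrite last_rcons rev_rcons => -> /=; rewrite orbT.
rewrite count_rev; apply: lt_le_trans h _; rewrite ler_pM2l // lerD2l lerN2 ler_pM2r //.
by rewrite ler_nat leq_addr.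
Qed.

Lemma in_rangeC u v : in_range u v = in_range v u.
Proof. by rewrite /in_range addnC. Qed.

(** The last b of the left word stands outside the whole operator of [v], and Fubini brings it
    inside, next to K. *)
Lemma Xop2_bl u v K : last true v -> in_range v (true :: u) -> good K ->
  Xop2 (true :: u) v K = Xop2 u v (Bop e K).
Proof.
move=> lv hr gK; rewrite /Xop2 rev_cons Xop_rcons_b; congr (Xop _ _ _ _).
apply/funext => y; have vv := valid_rev lv hr.
pose H (p : MR * MR) := K (y + (p.1 + p.2)).
have gH : @good2 _ omega _ MR H (fun s => expR (- m * s)).
  exact: (good2_add (good_shift y gK)).
have C := Bop_Xop_comm omega_gt0 e01 0 vv gH.
pose g z := cintegral (fun s => kern (2 * pi) (- e) s * H (s, z)).
have BE z : Bop e K (y + z) = 'i%C * g z.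
  rewrite /Bop /g; congr (_ * cintegral _); apply/funext => s.
  by rewrite /H /=; congr (_ * K _); ring.
have ii : 'i%C * 'i%C = -1 :> R[i] by rewrite -expr2 sqr_i.
(* The integral without its prefactor is recovered from [Bop] by dividing by i, which gives its
   bound for free. *)
have gg : good g.
  have -> : g = fun z => - 'i%C * Bop e K (y + z).
    by apply/funext => z; rewrite BE mulrA mulNr ii opprK mul1r.
  by apply: goodZ; apply: good_shift; exact: good_Bop.
transitivity ('i%C * Xop 0 (rev v) g 0).
  rewrite -C /Bop; congr (_ * cintegral _); apply/funext => s.
  congr (_ * Xop _ _ _ _); apply/funext => z.
  by rewrite /H /= addrA.
have Z := XopZ omega_gt0 e01 'i%C vv gg.
rewrite -[LHS]/((fun z => 'i%C * Xop 0 (rev v) g z) 0) -Z.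
by congr (Xop _ _ _ _); apply/funext => z; rewrite BE.
Qed.

Lemma Xop2_br u v K : Xop2 u (true :: v) K = Xop2 u v (Bop e K).
Proof.
rewrite /Xop2 rev_cons; congr (Xop _ _ _ _); apply/funext => y.
rewrite Xop_rcons_b; congr (Xop _ _ _ _); apply/funext => z.
by rewrite /Bop; congr (_ * cintegral _); apply/funext => t; rewrite addrA.
Qed.

Definition Gmul u v K y : R[i] :=
  Gfun (0 - (count id u + count id v)%:R * e) y * K y.

Lemma count_gt0 u : last true (false :: u) -> (0 < count id u)%N.
Proof.
case/lastP: u => // u b; rewrite -[last _ _]/(last false (rcons u b)) last_rcons => bT.
by rewrite -cats1 count_cat /= bT addn_gt0 orbT.
Qed.

Lemma last_cons_a u : last true (false :: u) -> last true u.
Proof. by case: u. Qed.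

(* 1/((X-1)(Y-1)) = (1/(X-1) + 1/(Y-1) + 1)/(XY-1) turns the two final letters a
   into the three terms of the shuffle recursion. *)
Lemma Xop2_aa u v K : last true (false :: u) -> last true (false :: v) ->
  in_range u v -> good (Gmul u v K) ->
  (forall y, good (fun y' => Gfun (0 - (count id v)%:R * e) y' * K (y + y'))) ->
  Xop2 (false :: u) (false :: v) K =
    Xop2 (false :: u) v (Gmul u v K) + Xop2 u (false :: v) (Gmul u v K) +
    hbarC omega * Xop2 u v (Gmul u v K).
Proof.
have := omega_gt0; have /andP[e0 _] := e01; move=> o0.
move=> lu lv hr gG gK.
have lu' := last_cons_a lu; have lv' := last_cons_a lv.
have vu : valid omega e 0 (rev u) by exact: valid_rev hr.
have vv : valid omega e 0 (rev v) by apply: (@valid_rev _ u); rewrite // in_rangeC.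
have vvf : valid omega e 0 (rev (false :: v)).
  by apply: (@valid_rev _ u); rewrite // in_rangeC.
(* Goodness is assumed of [L] and not of [K], which keeps the case K = 1 within reach. *)
set L := Gmul u v K in gG *.
pose a := 0 - (count id u)%:R * e; pose b := 0 - (count id v)%:R * e.
have a0 : a < 0 by rewrite /a sub0r oppr_lt0 mulr_gt0 // ltr0n count_gt0.
have b0 : b < 0 by rewrite /b sub0r oppr_lt0 mulr_gt0 // ltr0n count_gt0.
have abE : a + b = 0 - (count id u + count id v)%:R * e by rewrite /a /b natrD; ring.
have hab : -1 < omega * (a + b) by rewrite abE.
have ha : -1 < omega * a.
  by apply: lt_trans hab _; rewrite ltr_pM2l // gtrDl.
have hb : -1 < omega * b.
  by apply: lt_trans hab _; rewrite ltr_pM2l // gtrDr.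
pose V K' := Xop 0 (rev v) K'.
have gL y : good (fun y' => L (y + y')) by exact: good_shift.
have gGL y : good (fun y' => Gfun b y' * L (y + y')).
  exact: (good_Gfun_mul omega_gt0 e01 b0 hb (gL y)).
pose f1 y := V (fun y' => L (y + y')) 0.
pose f2 y := V (fun y' => Gfun b y' * L (y + y')) 0.
have g1 : good f1 by exact: good_inner.
have f2E : f2 = fun y => Xop 0 (rev (false :: v)) (fun y' => L (y + y')) 0.
  by apply/funext => y; rewrite rev_cons Xop_rcons_a count_rev.
have g2 : good f2 by rewrite f2E; exact: good_inner.
(* For fixed T the factor G(T) is constant for the operator in T', so it can be moved inside, where
   the partial fraction applies pointwise. *)
have key y : Gfun a y * V (fun y' => Gfun b y' * K (y + y')) 0 =
    Gfun a y * f1 y + (f2 y + hbarC omega * f1 y).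
  have Z := XopZ omega_gt0 e01 (Gfun a y) vv (gK y).
  rewrite -[LHS]/((fun z => Gfun a y * V (fun y' => Gfun b y' * K (y + y')) z) 0) -Z.
  have -> : (fun y' => Gfun a y * (Gfun b y' * K (y + y'))) =
    fun y' => Gfun a y * L (y + y') + (Gfun b y' * L (y + y') + hbarC omega * L (y + y')).
    apply/funext => y'; rewrite mulrA Gfun_mul // /L /Gmul -abE.
    by ring.
  rewrite (XopD omega_gt0 e01 vv); first last.
  - by apply: goodD; [exact: gGL|exact: goodZ].
  - exact: goodZ.
  rewrite (XopD omega_gt0 e01 vv); first last.
  - exact: goodZ.
  - exact: gGL.
  by rewrite !(XopZ omega_gt0 e01 _ vv).
have gaf : good (fun y => Gfun a y * f1 y).
  exact: (good_Gfun_mul omega_gt0 e01 a0 ha g1).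
rewrite {1}/Xop2 rev_cons Xop_rcons_a count_rev.
have -> : (fun y => Gfun a y * Xop 0 (rev (false :: v)) (fun y' => K (y + y')) 0) =
   fun y => Gfun a y * f1 y + (f2 y + hbarC omega * f1 y).
  apply/funext => y; rewrite -key rev_cons Xop_rcons_a count_rev; reflexivity.
rewrite (XopD omega_gt0 e01 vu gaf); last by apply: goodD => //; exact: goodZ.
rewrite (XopD omega_gt0 e01 vu g2); last exact: goodZ.
rewrite (XopZ omega_gt0 e01 _ vu g1) addrA; congr (_ + _ + _).
- by rewrite /Xop2 rev_cons Xop_rcons_a count_rev.
- by rewrite f2E.
Qed.

Lemma in_rangeS u v u' v' : (count id u' + count id v' <= count id u + count id v)%N ->
  in_range u v -> in_range u' v'.
Proof.
have := omega_gt0; have /andP[e0 _] := e01; move=> o0.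
move=> le; rewrite /in_range => h; apply: lt_le_trans h _.
by rewrite ler_pM2l // lerD2l lerN2 ler_pM2r // ler_nat.
Qed.

Lemma good_Gmul u v K : last true (false :: u) -> in_range u v -> good K ->
  good (Gmul u v K).
Proof.
have := omega_gt0; have /andP[e0 _] := e01; move=> o0.
move=> lu hr gK; apply: (good_Gfun_mul omega_gt0 e01) => //.
by rewrite sub0r oppr_lt0 mulr_gt0 // ltr0n addn_gt0 count_gt0.
Qed.

Lemma sum_Xop_a u v K (s : seq (nat * seq bool)) :
  (forall q, q \in s -> count id q.2 = (count id u + count id v)%N) ->
  \sum_(q <- s) hbarC omega ^+ q.1 * Xop 0 (rev q.2) (Gmul u v K) 0 =
  \sum_(q <- [seq (q.1, false :: q.2) | q <- s])
     hbarC omega ^+ q.1 * Xop 0 (rev q.2) K 0.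
Proof.
move=> hs; rewrite big_map; apply: eq_big_seq => q qs /=.
by rewrite rev_cons Xop_rcons_a count_rev hs.
Qed.

Lemma sum_shl_aa u v K :
  \sum_(q <- shl (false :: u) v) hbarC omega ^+ q.1 * Xop 0 (rev q.2) (Gmul u v K) 0 +
  \sum_(q <- shl u (false :: v)) hbarC omega ^+ q.1 * Xop 0 (rev q.2) (Gmul u v K) 0 +
  hbarC omega *
    \sum_(q <- shl u v) hbarC omega ^+ q.1 * Xop 0 (rev q.2) (Gmul u v K) 0 =
  \sum_(q <- shl (false :: u) (false :: v)) hbarC omega ^+ q.1 * Xop 0 (rev q.2) K 0.
Proof.
have c1 q : q \in shl (false :: u) v -> count id q.2 = (count id u + count id v)%N.
  exact: count_shl.
have c2 q : q \in shl u (false :: v) -> count id q.2 = (count id u + count id v)%N.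
  exact: count_shl.
have c3 q : q \in shl u v -> count id q.2 = (count id u + count id v)%N.
  exact: count_shl.
rewrite shl_aa map_cat !big_cat (sum_Xop_a K c1) (sum_Xop_a K c2) (sum_Xop_a K c3).
congr (_ + _); rewrite !big_map mulr_sumr; apply: eq_bigr => q _ /=.
by rewrite exprS mulrA.
Qed.

(** K varies in the induction: removing last letters replaces it by [Bop e K] or [Gmul u v K], which
    are good again. *)
Lemma Xop2_shl u v K : last true u -> last true v -> in_range u v -> good K ->
  Xop2 u v K = \sum_(q <- shl u v) hbarC omega ^+ q.1 * Xop 0 (rev q.2) K 0.
Proof.
move: u v K; apply: shl_ind => [v|u|u v v0 IH|u v IH|u v IH1 IH2 IH3] K lu lv hr gK.
- rewrite big_seq1 expr0 mul1r /Xop2 /=; congr (Xop _ _ _ _).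
  by apply/funext => y; rewrite add0r.
- rewrite shl_nilr big_seq1 expr0 mul1r /Xop2 /=; congr (Xop _ _ _ _).
  by apply/funext => y; rewrite addr0.
- rewrite Xop2_bl //; last by rewrite in_rangeC.
  rewrite IH //; last exact: good_Bop.
  + rewrite shl_bl // big_map; apply: eq_bigr => q _ /=.
    by rewrite rev_cons Xop_rcons_b.
  + by apply: in_rangeS hr => /=; lia.
- rewrite Xop2_br IH //; last exact: good_Bop.
  + rewrite shl_br big_map; apply: eq_bigr => q _ /=.
    by rewrite rev_cons Xop_rcons_b.
  + by apply: in_rangeS hr => /=; lia.
- have hr' : in_range u v by [].
  have gG := good_Gmul lu hr' gK.
  have lu' := last_cons_a lu; have lv' := last_cons_a lv.
  have := omega_gt0; have /andP[e0 _] := e01; move=> o0.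
  rewrite Xop2_aa //; last first.
    move=> y; apply: (good_Gfun_mul omega_gt0 e01) => //; last exact: good_shift.
      by rewrite sub0r oppr_lt0 mulr_gt0 // ltr0n count_gt0.
    apply: lt_le_trans hr' _.
    by rewrite ler_pM2l // lerD2l lerN2 ler_pM2r // ler_nat leq_addl.
  by rewrite IH1 // IH2 // IH3 // sum_shl_aa.
Qed.

Lemma Xop_mul u v : last true (false :: u) -> last true (false :: v) -> in_range u v ->
  Xop 0 (rev (false :: u)) (fun _ => 1) 0 * Xop 0 (rev (false :: v)) (fun _ => 1) 0 =
  \sum_(q <- shl (false :: u) (false :: v))
     hbarC omega ^+ q.1 * Xop 0 (rev q.2) (fun _ => 1) 0.
Proof.
have := omega_gt0; have /andP[e0 _] := e01; move=> o0.
move=> lu lv hr.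
have a0 u' : (0 < count id u')%N -> 0 - (count id u')%:R * e < 0.
  by move=> c; rewrite sub0r oppr_lt0 mulr_gt0 // ltr0n.
have lu' := last_cons_a lu; have lv' := last_cons_a lv.
have ha : -1 < omega * (0 - (count id u)%:R * e).
  apply: lt_le_trans hr _.
  by rewrite ler_pM2l // lerD2l lerN2 ler_pM2r // ler_nat leq_addr.
have hb : -1 < omega * (0 - (count id v)%:R * e).
  apply: lt_le_trans hr _.
  by rewrite ler_pM2l // lerD2l lerN2 ler_pM2r // ler_nat leq_addl.
have g1 x : x < 0 -> -1 < omega * x -> good (fun y => Gfun x y * 1).
  move=> x0 ox; have -> : (fun y => Gfun x y * 1) = Gfun x.
    by apply/funext => y; rewrite mulr1.
  exact: good_Gfun.
have gG : good (Gmul u v (fun _ => 1)).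
  by apply: g1 => //; rewrite sub0r oppr_lt0 mulr_gt0 // ltr0n addn_gt0 count_gt0.
(* For K = 1 the inner operator returns a constant, which linearity takes out of the outer one once
   the last letter a has turned 1 into the good function G. *)
transitivity (Xop2 (false :: u) (false :: v) (fun _ => 1)).
  have E : Xop 0 (rev (false :: u)) (fun _ => 1) 0 =
      Xop 0 (rev u) (Gfun (0 - (count id u)%:R * e)) 0.
    rewrite rev_cons Xop_rcons_a count_rev; congr (Xop _ _ _ _).
    by apply/funext => y; rewrite mulr1.
  have vu : valid omega e 0 (rev u) by exact: valid_rev hr.
  rewrite /Xop2 E; set c := Xop 0 (rev (false :: v)) _ 0.
  rewrite rev_cons Xop_rcons_a count_rev.
  have gu := good_Gfun omega_gt0 (a0 _ (count_gt0 lu)) ha.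
  under [in RHS]eq_fun do rewrite mulrC.
  by rewrite (XopZ omega_gt0 e01 c vu gu) mulrC.
rewrite Xop2_aa //; last by move=> y; apply: g1 => //; exact: a0 (count_gt0 lv).
by rewrite !Xop2_shl // sum_shl_aa.
Qed.

End ShuffleOperators.

(** * Holomorphy and translation of contours *)

Section SmallAngles.
Variable R : realType.
Implicit Types u : R.

Lemma normr_sin_le u : `|sin u| <= `|u|.
Proof.
wlog u0 : u / 0 <= u.
  move=> H; have [/H//|/ltW u0] := leP 0 u.
  by have := H (- u); rewrite sinN !normrN oppr_ge0; exact.
have [c _ ] := @MVT_segment R sin cos 0 u u0 (fun x _ => is_derive_sin x)
  (@continuous_subspaceT _ _ _ _ (@continuous_sin R)).
rewrite sin0 !subr0 => ->; rewrite normrM ler_piMl //.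
by rewrite ler_norml cos_le1 cos_geN1.
Qed.

Lemma normr_cosB1_le u : `|cos u - 1| <= u ^+ 2.
Proof.
have := cos_mulr2n (u / 2); rewrite -[_ *+ 2]mulr_natr divfK ?pnatr_eq0 // => ->.
rewrite cos2sin2.
have -> : (1 - sin (u / 2) ^+ 2) *+ 2 - 1 - 1 = - (2 * sin (u / 2) ^+ 2) by ring.
rewrite normrN ger0_norm; last by apply: mulr_ge0 => //; exact: sqr_ge0.
have : sin (u / 2) ^+ 2 <= (u / 2) ^+ 2.
  rewrite -[leLHS]real_normK ?num_real // -[leRHS]real_normK ?num_real //.
  by rewrite lerXn2r ?nnegrE // normr_sin_le.
have -> : (u / 2) ^+ 2 = u ^+ 2 / 4 by field.
by have := sqr_ge0 u; lra.
Qed.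

Lemma normr_sinB_le u : `|sin u - u| <= `|u| ^+ 3.
Proof.
wlog u0 : u / 0 <= u.
  move=> H; have [/H//|/ltW u0] := leP 0 u.
  by have := H (- u); rewrite sinN -opprD !normrN oppr_ge0; exact.
have [c + ] := @MVT_segment R sin cos 0 u u0 (fun x _ => is_derive_sin x)
  (@continuous_subspaceT _ _ _ _ (@continuous_sin R)).
rewrite in_itv /= sin0 !subr0 => /andP[c0 cu] ->.
have -> : cos c * u - u = (cos c - 1) * u by ring.
rewrite normrM exprSr ler_wpM2r //; apply: le_trans (normr_cosB1_le c) _.
by rewrite lerXn2r ?nnegrE // ger0_norm.
Qed.

Lemma normr_expRNB1_le u : `|expR (- u) - 1| <= `|u| * expR `|u|.
Proof.
have h1 := expR_ge1Dx (- u); have h2 := expR_ge1Dx u; have p := expR_gt0 (- u).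
have e1 : expR u * expR (- u) = 1 by rewrite -expRD subrr expR0.
case: (leP 0 u) => u0.
  have le1 : expR (- u) <= 1 by rewrite expR_le1 oppr_le0.
  have hu : 0 <= u * (expR u - 1) by rewrite mulr_ge0 //; lra.
  rewrite (ger0_norm u0) ler_norml; apply/andP; split; lra.
have ge1 : 1 <= expR (- u) by lra.
have := ler_wpM2l (ltW p) h2; rewrite (mulrC _ (expR u)) e1.
by rewrite (ltr0_norm u0) ger0_norm ?subr_ge0 // => h; lra.
Qed.

Lemma normr_expRNB1D_le u : `|expR (- u) - 1 + u| <= u ^+ 2 * expR `|u|.
Proof.
have h1 := expR_ge1Dx (- u); have h2 := expR_ge1Dx u; have p := expR_gt0 (- u).
have e1 : expR u * expR (- u) = 1 by rewrite -expRD subrr expR0.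
rewrite ger0_norm; last lra.
(* This is e^{- u} (1 + u) <= 1, and it reduces the second-order bound to the first-order one. *)
have hA : expR (- u) - 1 + u <= u * (1 - expR (- u)) by nra.
apply: le_trans hA _; apply: le_trans (ler_norm _) _.
rewrite normrM -[u ^+ 2]real_normK ?num_real // expr2 -mulrA ler_wpM2l //.
by rewrite distrC normr_expRNB1_le.
Qed.

End SmallAngles.

(** * Discrete Cauchy-Riemann estimates *)

Section Holomorphic.
Variable R : realType.
Notation normc := (@Normc.normc R).
Notation MR := (measurableTypeR R).
Implicit Types (a b x y d : R) (K : R -> R -> R[i]).

(* Quantitative holomorphy of [K (x + i y)] on the strip [a <= x <= b], with growth
   [expR (beta * y)]; the last bound is a discrete Cauchy-Riemann equation. *)
Definition hol (beta a b : R) K : Prop :=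
  (forall x, a <= x <= b -> @cmeasurable R _ MR (K x)) /\
  exists2 C : R, 0 <= C & forall x y d, a <= x -> 0 <= d <= 1 -> x + d <= b ->
   [/\ normc (K x y) <= C * expR (beta * y),
       normc (K (x + d) y - K x y) <= C * d * expR (beta * y),
       normc (K x (y + d) - K x y) <= C * d * expR (beta * y) &
       normc (K (x + d) y - K x y + 'i%C * (K x (y + d) - K x y))
         <= C * d ^+ 2 * expR (beta * y)].

Lemma normcM_le (x y : R[i]) (A B : R) : normc x <= A -> normc y <= B ->
  normc (x * y) <= A * B.
Proof. by move=> h1 h2; rewrite Normc.normcM ler_pM ?normc_ge0. Qed.

Lemma normcD_le (x y : R[i]) (A B : R) : normc x <= A -> normc y <= B ->
  normc (x + y) <= A + B.
Proof. by move=> h1 h2; apply: le_trans (le_normcD _ _) _; exact: lerD. Qed.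

Lemma normc_mul_i (x : R[i]) : normc ('i%C * x) = normc x.
Proof. by rewrite Normc.normcM normc_i mul1r. Qed.

Lemma hol_mul beta1 beta2 a b K1 K2 : hol beta1 a b K1 -> hol beta2 a b K2 ->
  hol (beta1 + beta2) a b (fun x y => K1 x y * K2 x y).
Proof.
move=> [m1 [C1 C10 h1]] [m2 [C2 C20 h2]]; split.
  by move=> x xab; apply: cmeasurableM; [exact: m1|exact: m2].
(* The Cauchy-Riemann defect of a product splits into four terms, each at most C1 C2 d^2; in the
   first-order bounds d <= 1 absorbs the quadratic term. *)
exists (4 * (C1 * C2)); first by rewrite !mulr_ge0.
move=> x y d ax d01 xd; have [p1 p2 p3 p4] := h1 x y d ax d01 xd.
have [q1 q2 q3 q4] := h2 x y d ax d01 xd.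
have -> : expR ((beta1 + beta2) * y) = expR (beta1 * y) * expR (beta2 * y).
  by rewrite mulrDl expRD.
move: p1 p2 p3 p4 q1 q2 q3 q4.
set E1 := expR (beta1 * y); set E2 := expR (beta2 * y).
set p := K1 x y; set px := K1 (x + d) y; set py := K1 x (y + d).
set q := K2 x y; set qx := K2 (x + d) y; set qy := K2 x (y + d).
move=> p1 p2 p3 p4 q1 q2 q3 q4.
have E10 : 0 <= E1 by exact: expR_ge0.
have E20 : 0 <= E2 by exact: expR_ge0.
have P0 : 0 <= C1 * C2 * (E1 * E2) by rewrite !mulr_ge0.
have /andP[d0 d1] := d01.
have step (p' q' : R[i]) : normc (p' - p) <= C1 * d * E1 -> normc (q' - q) <= C2 * d * E2 ->
    normc (p' * q' - p * q) <= 4 * (C1 * C2) * d * (E1 * E2).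
  move=> hp hq.
  have -> : p' * q' - p * q = (p' - p) * (q' - q) + (p' - p) * q + p * (q' - q) by ring.
  apply: le_trans (normcD_le (normcD_le (normcM_le hp hq) (normcM_le hp q1)) (normcM_le p1 hq)) _.
  have h : 0 <= C1 * C2 * (E1 * E2) * (d * (1 - d)) by rewrite mulr_ge0 // mulr_ge0 // subr_ge0.
  have h' : 0 <= C1 * C2 * (E1 * E2) * d by rewrite mulr_ge0.
  nra.
split.
- apply: le_trans (normcM_le p1 q1) _; nra.
- exact: step.
- exact: step.
- have -> : px * qx - p * q + 'i%C * (py * qy - p * q) =
      p * (qx - q + 'i%C * (qy - q)) + (px - p + 'i%C * (py - p)) * q +
      ((px - p) * (qx - q) + 'i%C * ((py - p) * (qy - q))) by ring.
  have hi : normc ('i%C * ((py - p) * (qy - q))) <= (C1 * d * E1) * (C2 * d * E2).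
    by rewrite normc_mul_i; exact: normcM_le.
  apply: le_trans (normcD_le (normcD_le (normcM_le p1 q4) (normcM_le p4 q1))
    (normcD_le (normcM_le p2 q2) hi)) _.
  by rewrite le_eqVlt; apply/orP; left; apply/eqP; ring.
Qed.

Lemma hol_cst (c : R[i]) a b : hol 0 a b (fun _ _ => c).
Proof.
split=> [x _|]; first exact: cmeasurable_cst.
exists (normc c) => [|x y d _ /andP[d0 d1] _]; first exact: normc_ge0.
rewrite mul0r expR0 !mulr1 subrr mulr0 addr0 Normc.normc0.
by split; rewrite ?mulr_ge0 ?normc_ge0 ?sqr_ge0.
Qed.

(** As [eexp] is multiplicative, its increments at any point reduce to these increments at 0. *)
Lemma eexp_increments (alpha : R) : exists2 A : R, 0 <= A & forall d, 0 <= d <= 1 ->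
  [/\ normc (eexp alpha d 0 - 1) <= A * d, normc (eexp alpha 0 d - 1) <= A * d &
      normc (eexp alpha d 0 - 1 + 'i%C * (eexp alpha 0 d - 1)) <= A * d ^+ 2].
Proof.
set B := `|alpha|; have B0 : 0 <= B by exact: normr_ge0.
exists (B + B ^+ 2 + B ^+ 3 + B * expR B + B ^+ 2 * expR B).
  by rewrite !addr_ge0 ?mulr_ge0 ?exprn_ge0 ?expR_ge0.
move=> d /andP[d0 d1]; have eB := expR_ge0 B.
have nu : `|alpha * d| = B * d by rewrite normrM (ger0_norm d0).
have nu1 : B * d <= B by rewrite ler_piMr.
have ed : expR (B * d) <= expR B by rewrite ler_expR.
have s1 := normr_sin_le (alpha * d); have s2 := normr_cosB1_le (alpha * d).
have s3 := normr_sinB_le (alpha * d); have s4 := normr_expRNB1_le (alpha * d).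
have s5 := normr_expRNB1D_le (alpha * d).
rewrite -[(alpha * d) ^+ 2]real_normK ?num_real // in s2 s5.
rewrite nu in s1 s2 s3 s4 s5.
have dd : d ^+ 2 <= d by rewrite expr2 ler_piMl.
have B2 : 0 <= B ^+ 2 by exact: sqr_ge0.
have B3 : 0 <= B ^+ 3 by exact: exprn_ge0.
have BE : 0 <= B * expR B by exact: mulr_ge0.
have BBE : 0 <= B ^+ 2 * expR B by exact: mulr_ge0.
have d2 : 0 <= d ^+ 2 by exact: sqr_ge0.
have d3 : d ^+ 3 <= d ^+ 2 by rewrite exprS ler_piMl.
have E1 : eexp alpha d 0 - 1 = (cos (alpha * d) - 1) +i* sin (alpha * d).
  rewrite eexpE mulr0 expR0 !mul1r.
  by apply/eqP; rewrite eq_complex /= subr0 !eqxx.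
have E2 : eexp alpha 0 d - 1 = (expR (- (alpha * d)) - 1)%:C.
  rewrite eexpE mulr0 cos0 sin0 mulr1 mulr0 mulNr.
  by apply/eqP; rewrite eq_complex /= subrr !eqxx.
have t2 : `|cos (alpha * d) - 1| <= B ^+ 2 * d ^+ 2 by rewrite -exprMn.
have t3 : `|sin (alpha * d) - alpha * d| <= B ^+ 3 * d ^+ 2.
  by apply: le_trans s3 _; rewrite exprMn ler_wpM2l.
have t4 : `|expR (- (alpha * d)) - 1| <= B * expR B * d.
  by apply: le_trans s4 _; rewrite mulrAC ler_wpM2r // ler_wpM2l.
have t5 : `|expR (- (alpha * d)) - 1 + alpha * d| <= B ^+ 2 * expR B * d ^+ 2.
  by apply: le_trans s5 _; rewrite exprMn mulrAC ler_wpM2r // ler_wpM2l.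
have t2' : B ^+ 2 * d ^+ 2 <= B ^+ 2 * d by rewrite ler_wpM2l.
split.
- rewrite E1; apply: le_trans (normc_le_ReIm _) _ => /=.
  rewrite !mulrDl; have := mulr_ge0 B3 d0; have := mulr_ge0 BE d0; have := mulr_ge0 BBE d0.
  lra.
- rewrite E2 normc_real !mulrDl.
  have := mulr_ge0 B3 d0; have := mulr_ge0 B2 d0; have := mulr_ge0 BBE d0.
  have := mulr_ge0 B0 d0; lra.
(* The first-order terms are + alpha d from the sine and - alpha d from the exponential; adding and
   subtracting alpha d isolates the two remainders. *)
- have -> : eexp alpha d 0 - 1 + 'i%C * (eexp alpha 0 d - 1) =
    (cos (alpha * d) - 1) +i*
      ((sin (alpha * d) - alpha * d) + (expR (- (alpha * d)) - 1 + alpha * d)).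
    rewrite E1 E2; apply/eqP; rewrite eq_complex /= !mul0r !mul1r; apply/andP; split; apply/eqP; ring.
  apply: le_trans (normc_le_ReIm _) _ => /=.
  have := ler_normD (sin (alpha * d) - alpha * d) (expR (- (alpha * d)) - 1 + alpha * d).
  rewrite !mulrDl; have := mulr_ge0 B0 d2; have := mulr_ge0 BE d2.
  lra.
Qed.

(** With X and Y the two exponentials, 1/(XY - 1) - 1/(X - 1) = - (Y - 1) X / ((X - 1)(XY - 1)), and
    X/(X - 1) = 1 + 1/(X - 1). *)
Lemma kern_increment (alpha x y x' y' : R) : eexp alpha x y - 1 != 0 ->
  eexp alpha (x + x') (y + y') - 1 != 0 ->
  kern alpha (x + x') (y + y') - kern alpha x y =
  - ((eexp alpha x' y' - 1) * ((1 + kern alpha x y) * kern alpha (x + x') (y + y'))).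
Proof.
by rewrite /kern eexpD => h1 h2; field; rewrite h1 h2.
Qed.

Lemma hol_kern (alpha beta a b : R) : a <= b -> off_period alpha a b ->
  (0 <= beta <= alpha) || (alpha <= beta <= 0) -> hol beta a b (kern alpha).
Proof.
move=> ab off hb; split; first by move=> x _; exact: cmeasurable_kern.
have hb0 : ((0 : R) <= 0 <= alpha) || (alpha <= 0 <= (0 : R)).
  apply/orP; case/orP: hb => /andP[h1 h2]; [left|right];
    by rewrite lexx ?andbT /=; exact: le_trans h1 h2.
(* In an increment the factor 1 + kern takes exponent 0 and the other kernel exponent beta, so the
   product grows only like e^{beta y}. *)
have [C0 C00 f0] := kern_bound ab off hb0.
have [C1 C10 f1] := kern_bound ab off hb.
have [A A0 hA] := eexp_increments alpha.
(* This is the cost of replacing y + d by y in the weight, as d <= 1. *)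
set B := expR `|beta|; have B1 : 1 <= B by rewrite -(@expR0 R) ler_expR.
have C00' := ltW C00; have C10' := ltW C10.
set D := (1 + C0) * A * (C1 * B).
have D0 : 0 <= D by rewrite !mulr_ge0 ?addr_ge0 //; lra.
have T0 : 0 <= (1 + C0) * A * (C1 + D + D).
  by apply: mulr_ge0; [apply: mulr_ge0 => //|]; lra.
exists (C1 + D + (1 + C0) * A * (C1 + D + D)); first lra.
move=> x y d ax d01 xd; have /andP[d0 d1] := d01; set E := expR (beta * y).
have E0 : 0 <= E by exact: expR_ge0.
have xab : a <= x <= b by rewrite ax /=; apply: le_trans xd; rewrite lerDl.
have xdab : a <= x + d <= b by rewrite xd andbT; apply: le_trans ax _; rewrite lerDl.
have [c1 c2 c3] := hA d d01.
have g0 : normc (1 + kern alpha x y) <= 1 + C0.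
  apply: le_trans (le_normcD _ _) _; rewrite Normc.normc1 lerD2l.
  by have := f0 x y xab; rewrite mul0r expR0 mulr1.
have g1 := f1 x y xab; rewrite -/E in g1.
have BE : C1 * E <= C1 * B * E by rewrite ler_wpM2r // ler_peMr.
have g2 : normc (kern alpha (x + d) (y + 0)) <= C1 * B * E.
  by apply: le_trans (f1 _ _ xdab) _; rewrite addr0.
have g3 : normc (kern alpha (x + 0) (y + d)) <= C1 * B * E.
  rewrite addr0; apply: le_trans (f1 _ _ xab) _; rewrite mulrDr expRD.
  rewrite -mulrA [B * _]mulrC ler_wpM2l // ler_wpM2l // ler_expR.
  by apply: le_trans (ler_norm _) _; rewrite normrM (ger0_norm d0) ler_piMr.
have n1 : eexp alpha x y - 1 != 0 by apply: eexpB1_neq0; exact: off.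
have n2 : eexp alpha (x + d) (y + 0) - 1 != 0 by apply: eexpB1_neq0; exact: off.
have n3 : eexp alpha (x + 0) (y + d) - 1 != 0.
  by apply: eexpB1_neq0; rewrite addr0; exact: off.
have i1 := kern_increment n1 n2; have i2 := kern_increment n1 n3.
have b1 : normc (kern alpha (x + d) (y + 0) - kern alpha x y) <= D * d * E.
  rewrite i1 normcN; apply: le_trans (normcM_le c1 (normcM_le g0 g2)) _.
  by rewrite le_eqVlt; apply/orP; left; apply/eqP; rewrite /D; ring.
have b2 : normc (kern alpha (x + 0) (y + d) - kern alpha x y) <= D * d * E.
  rewrite i2 normcN; apply: le_trans (normcM_le c2 (normcM_le g0 g3)) _.
  by rewrite le_eqVlt; apply/orP; left; apply/eqP; rewrite /D; ring.
have DE : D * d * E <= (C1 + D + (1 + C0) * A * (C1 + D + D)) * d * E.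
  by do 2 apply: ler_wpM2r => //; lra.
rewrite (addr0 x) in i2 b2; rewrite (addr0 y) in i1 b1.
split.
- apply: le_trans g1 _; rewrite ler_wpM2r //; lra.
- exact: le_trans b1 DE.
- exact: le_trans b2 DE.
(* The shifted kernel in each increment is expanded around the base point: the defect of [eexp]
   appears with the unshifted kernel, and all else is a product of two increments. *)
have -> : kern alpha (x + d) y - kern alpha x y +
    'i%C * (kern alpha x (y + d) - kern alpha x y) =
  - ((1 + kern alpha x y) *
    ((eexp alpha d 0 - 1 + 'i%C * (eexp alpha 0 d - 1)) * kern alpha x y +
     (eexp alpha d 0 - 1) * (kern alpha (x + d) y - kern alpha x y) +
     'i%C * ((eexp alpha 0 d - 1) * (kern alpha x (y + d) - kern alpha x y)))).
  rewrite {1}i1 {1}i2; ring.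
rewrite normcN.
have hi : normc ('i%C * ((eexp alpha 0 d - 1) * (kern alpha x (y + d) - kern alpha x y)))
    <= A * d * (D * d * E).
  by rewrite normc_mul_i; exact: normcM_le.
apply: le_trans (normcM_le g0 (normcD_le (normcD_le (normcM_le c3 g1) (normcM_le c1 b1)) hi)) _.
have -> : (1 + C0) * (A * d ^+ 2 * (C1 * E) + A * d * (D * d * E) + A * d * (D * d * E)) =
  (1 + C0) * A * (C1 + D + D) * d ^+ 2 * E by ring.
do 2 apply: ler_wpM2r => //; first exact: sqr_ge0.
by rewrite lerDr addr_ge0.
Qed.

Lemma hol_translate beta a b x0 y0 K : hol beta a b K ->
  hol beta (a - x0) (b - x0) (fun x y => K (x0 + x) (y0 + y)).
Proof.
move=> [mK [C C0 hC]]; split.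
  move=> x /andP[x1 x2]; apply: (cmeasurable_shift y0 (mK (x0 + x) _)).
  by apply/andP; split; lra.
exists (C * expR (beta * y0)); first by rewrite mulr_ge0 ?expR_ge0.
move=> x y d ax d01 xd.
have [||h1 h2 h3 h4] := hC (x0 + x) (y0 + y) d _ d01 _.
- lra.
- lra.
have S (r : R) : r * expR (beta * (y0 + y)) = r * expR (beta * y0) * expR (beta * y).
  by rewrite mulrDr expRD mulrA.
rewrite !addrA; split.
- by rewrite -S.
- by rewrite (mulrAC C) -S.
- by rewrite (mulrAC C) -S.
- by rewrite (mulrAC C) -S.
Qed.

Lemma le_expR_abs (m B y : R) (z : R) : 0 <= B ->
  z <= B * expR (- m * y) -> z <= B * expR (m * y) -> z <= B * expR (- m * `|y|).
Proof.
move=> B0 h1 h2; case: (leP 0 y) => y0; first by rewrite ger0_norm.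
by rewrite ltr0_norm // mulrNN.
Qed.

(** Growth bounds with exponents m and - m together amount to decay like e^{- m |y|}, which makes
    every integral involved converge. *)
Lemma hol_integral_step (m a b : R) K : 0 < m -> hol (- m) a b K -> hol m a b K ->
  exists2 A : R, 0 <= A & forall x d, a <= x -> 0 <= d <= 1 -> x + d <= b ->
    normc (cintegral (K (x + d)) - cintegral (K x)) <= A * d ^+ 2.
Proof.
move=> m0 [mK [C1 C10 h1]] [_ [C2 C20 h2]].
set C := C1 + C2; have C0 : 0 <= C by exact: addr_ge0.
have iw (c : R) : (@lebesgue_measure R).-integrable setT
    (EFin \o (fun y => c * expR (- m * `|y|))).
  rewrite (_ : EFin \o _ = fun y => (c%:E * (EFin \o (fun y => expR (- m * `|y|))) y)%E) //.
  by apply: integrableZl => //; exact: integrable_expR_abs.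
have iK x : a <= x <= b -> cintegrable (K x).
  move=> /andP[ax xb]; apply: (cintegrable_dom (iw C)); first by apply: mK; rewrite ax.
  have d01 : 0 <= (0 : R) <= 1 by rewrite lexx ler01.
  move=> y; have [|p _ _ _] := h1 x y 0 ax d01 _; first by rewrite addr0.
  have [|q _ _ _] := h2 x y 0 ax d01 _; first by rewrite addr0.
  apply: le_expR_abs => //.
  + by apply: le_trans p _; rewrite ler_wpM2r ?expR_ge0 // lerDl.
  + by apply: le_trans q _; rewrite ler_wpM2r ?expR_ge0 // lerDr.
pose J := Rintegral (@lebesgue_measure R) setT (fun y => expR (- m * `|y|)).
have J0 : 0 <= J by apply: Rintegral_ge0 => y _; exact: expR_ge0.
exists (2 * C * J); first by rewrite !mulr_ge0.
move=> x d ax d01 xd; have /andP[d0 d1] := d01.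
have xab : a <= x <= b by rewrite ax /=; apply: le_trans xd; rewrite lerDl.
have xdab : a <= x + d <= b by rewrite xd andbT; apply: le_trans ax _; rewrite lerDl.
have mx := mK x xab; have mxd := mK _ xdab.
have msh : @cmeasurable R _ MR (fun y => K x (y + d)).
  apply: (cmeasurable_comp (h := fun y : MR => (y + d : MR)) _ mx).
  exact: measurable_shift.
have ish : cintegrable (fun y => K x (y + d)).
  apply: (cintegrable_dom (iw (C + C))) => // y.
  have [p1 _ p3 _] := h1 x y d ax d01 xd; have [q1 _ q3 _] := h2 x y d ax d01 xd.
  have tri : normc (K x (y + d)) <= normc (K x (y + d) - K x y) + normc (K x y).
    by rewrite -{1}[K x (y + d)](subrK (K x y)); exact: le_normcD.
  apply: le_expR_abs; first exact: addr_ge0.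
  + apply: le_trans tri _; rewrite mulrDl; apply: lerD.
      apply: le_trans p3 _; rewrite ler_wpM2r ?expR_ge0 //.
      by apply: (@le_trans _ _ C1); [rewrite ler_piMr|rewrite lerDl].
    by apply: le_trans p1 _; rewrite ler_wpM2r ?expR_ge0 // lerDl.
  + apply: le_trans tri _; rewrite mulrDl; apply: lerD.
      apply: le_trans q3 _; rewrite ler_wpM2r ?expR_ge0 //.
      by apply: (@le_trans _ _ C2); [rewrite ler_piMr|rewrite lerDr].
    by apply: le_trans q1 _; rewrite ler_wpM2r ?expR_ge0 // lerDr.
pose L y := K (x + d) y - K x y + 'i%C * (K x (y + d) - K x y).
(* By translation invariance of the integral only the Cauchy-Riemann defect survives. *)
have -> : cintegral (K (x + d)) - cintegral (K x) = cintegral L.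
  have E1 := cintegralB (iK _ xdab) (iK _ xab).
  have E2 := cintegralB ish (iK _ xab).
  have E3 : cintegral (fun y => K x (y + d) - K x y) = 0.
    by rewrite E2 (cintegral_shift d mx) subrr.
  have i1 := cintegrableB (iK _ xdab) (iK _ xab); have i2 := cintegrableB ish (iK _ xab).
  have i3 := cintegrableZ 'i%C i2.
  by rewrite /L (cintegralD i1 i3) E1 (cintegralZ 'i%C i2) E3 mulr0 addr0.
have mL : @cmeasurable R _ MR L.
  apply: cmeasurableD; first by apply: cmeasurableD => //; exact: cmeasurableN.
  apply: cmeasurableM; first exact: cmeasurable_cst.
  by apply: cmeasurableD => //; exact: cmeasurableN.
have := normc_cintegral_leM (c := C * d ^+ 2) (integrable_expR_abs m0) mL.
have -> : 2 * C * J * d ^+ 2 = 2 * (C * d ^+ 2) * J by ring.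
apply => y; have [_ _ _ p4] := h1 x y d ax d01 xd; have [_ _ _ q4] := h2 x y d ax d01 xd.
have dd := sqr_ge0 d.
apply: le_expR_abs; first exact: mulr_ge0.
- apply: le_trans p4 _; rewrite ler_wpM2r ?expR_ge0 // ler_wpM2r //.
  by rewrite lerDl.
- apply: le_trans q4 _; rewrite ler_wpM2r ?expR_ge0 // ler_wpM2r //.
  by rewrite lerDr.
Qed.

Lemma hol_integral_cst (m a b : R) K : 0 < m -> a <= b ->
  hol (- m) a b K -> hol m a b K -> cintegral (K a) = cintegral (K b).
Proof.
move=> m0 ab k1 k2; have [A A0 hA] := hol_integral_step m0 k1 k2.
set D := normc (cintegral (K b) - cintegral (K a)).
have bnd n : b - a <= n.+1%:R -> D * n.+1%:R <= A * (b - a) ^+ 2.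
  move=> hn; have n0 : 0 < n.+1%:R :> R by rewrite ltr0n.
  set d := (b - a) / n.+1%:R.
  have nd : n.+1%:R * d = b - a by rewrite /d mulrC divfK // gt_eqF.
  have d01 : 0 <= d <= 1.
    by rewrite /d ler_pdivrMr // mul1r hn divr_ge0 ?subr_ge0 // ltW.
  have /andP[d0 _] := d01.
  have tele k : (k <= n.+1)%N ->
      normc (cintegral (K (a + k%:R * d)) - cintegral (K a)) <= k%:R * (A * d ^+ 2).
    elim: k => [_|k IH kn]; first by rewrite !mul0r addr0 subrr Normc.normc0.
    have -> : cintegral (K (a + k.+1%:R * d)) - cintegral (K a) =
      (cintegral (K (a + k%:R * d + d)) - cintegral (K (a + k%:R * d))) +
      (cintegral (K (a + k%:R * d)) - cintegral (K a)).
      have -> : a + k%:R * d + d = a + k.+1%:R * d by rewrite -natr1; ring.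
      by rewrite addrA subrK.
    apply: le_trans (le_normcD _ _) _; rewrite -natr1 mulrDl mul1r addrC.
    apply: lerD; first by apply: IH; exact: ltnW.
    apply: hA => //; first by rewrite lerDl mulr_ge0.
    have -> : a + k%:R * d + d = a + k.+1%:R * d by rewrite -natr1; ring.
    by rewrite -lerBrDl -nd ler_wpM2r // ler_nat.
  have aba : a + (b - a) = b by ring.
  have := tele n.+1 (leqnn _); rewrite nd aba -/D => h.
  apply: (@le_trans _ _ (n.+1%:R * (A * d ^+ 2) * n.+1%:R)).
    by rewrite ler_wpM2r // ltW.
  have -> : n.+1%:R * (A * d ^+ 2) * n.+1%:R = A * (n.+1%:R * d) ^+ 2 by ring.
  by rewrite nd.
have D0 : D = 0.
  apply/eqP; rewrite eq_le normc_ge0 andbT; apply/negPn; rewrite -ltNge; apply/negP => Dp.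
  (* More than M steps make each of them at most 1 and contradict D n <= A (b - a)^2. *)
  set M := (b - a) + A * (b - a) ^+ 2 / D.
  have M0 : 0 <= M.
    by rewrite addr_ge0 ?subr_ge0 // divr_ge0 ?normc_ge0 // mulr_ge0 // sqr_ge0.
  have := archi_boundP M0; set n := Num.Def.archi_bound M => hn.
  have hn1 : M < n.+1%:R by apply: lt_trans hn _; rewrite ltr_nat.
  have hb1 : b - a <= n.+1%:R.
    apply: le_trans (ltW hn1); rewrite lerDl divr_ge0 ?normc_ge0 //.
    by rewrite mulr_ge0 // sqr_ge0.
  have := bnd n hb1; apply/negP.
  rewrite -ltNge [D * _]mulrC -ltr_pdivrMr //; apply: le_lt_trans hn1.
  by rewrite lerDr subr_ge0.
by apply/esym/eqP; rewrite -subr_eq0; apply/eqP; exact: Normc.eq0_normc.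
Qed.

End Holomorphic.

(** * Independence of the contour *)

Section ContourShift.
Variables (R : realType) (omega : R).
Hypothesis omega_gt0 : 0 < omega.
Notation normc := (@Normc.normc R).
Notation MR := (measurableTypeR R).
Notation m := (decay omega).
Implicit Types (e x y : R) (w : seq bool).

(** The factor M does not depend on the function, so one constant serves for a function, its
    increments and its Cauchy-Riemann defect. *)
Lemma normc_Bop_le e : 0 < e < 1 -> exists2 M : R, 0 <= M & forall K C,
  @cmeasurable R _ MR K -> 0 <= C -> (forall y, normc (K y) <= C * expR (- m * y)) ->
  forall y, normc (Bop e K y) <= M * C * expR (- m * y).
Proof.
move=> e01; have [Ck Ck0 hk] := kern_weight omega_gt0 e01.
pose J := Rintegral (@lebesgue_measure R) setT (wt omega).
have J0 : 0 <= J by apply: Rintegral_ge0 => y _; exact: expR_ge0.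
exists (2 * Ck * J); first by rewrite !mulr_ge0 // ltW.
move=> K C mK C0 hK y; rewrite normc_Bop.
have mF : @cmeasurable R _ MR (fun t => kern (2 * pi) (- e) t * K (y + t)).
  by apply: cmeasurableM; [exact: cmeasurable_kern|exact: cmeasurable_shift].
have -> : 2 * Ck * J * C * expR (- m * y) = 2 * (C * expR (- m * y) * Ck) * J by ring.
apply: (normc_cintegral_leM (integrable_expR_abs (decay_gt0 omega_gt0)) mF) => t.
rewrite Normc.normcM; apply: le_trans (ler_wpM2l (normc_ge0 _) (hK (y + t))) _.
have -> : expR (- m * (y + t)) = expR (- m * y) * expR (- m * t).
  by rewrite -expRD -mulrDr.
have -> : normc (kern (2 * pi) (- e) t) * (C * (expR (- m * y) * expR (- m * t))) =
  C * expR (- m * y) * (normc (kern (2 * pi) (- e) t) * expR (- m * t)) by ring.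
by rewrite -[leRHS]mulrA ler_wpM2l ?hk // mulr_ge0 ?expR_ge0.
Qed.

(** [Bop] is linear and commutes with translations in y, hence with forming increments and defects,
    and it preserves the weight. *)
Lemma hol_Bop e a b (K : R -> R -> R[i]) : 0 < e < 1 -> hol (- m) (a - e) (b - e) K ->
  hol (- m) a b (fun x => Bop e (K (x - e))).
Proof.
move=> e01 hK; have [mK [C C0 hC]] := hK.
have [M M0 hM] := normc_Bop_le e01.
have gK x : a <= x <= b -> good omega (K (x - e)).
  move=> /andP[ax xb]; split; first by apply: mK; apply/andP; split; lra.
  have d01 : 0 <= (0 : R) <= 1 by rewrite lexx ler01.
  have a1 : a - e <= x - e by lra.
  have a2 : x - e + 0 <= b - e by lra.
  by exists C => // y; have [h _ _ _] := hC (x - e) y 0 a1 d01 a2.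
split=> [x xab|]; first by have [] := good_Bop omega_gt0 e01 (gK x xab).
exists (M * C); first exact: mulr_ge0.
move=> x y d ax d01 xd; have /andP[d0 d1] := d01.
have xab : a <= x <= b by apply/andP; split; lra.
have xdab : a <= x + d <= b by apply/andP; split; lra.
have bnd z : _ := hC (x - e) z d _ d01 _.
have ax' : a - e <= x - e by lra.
have xd' : x - e + d <= b - e by lra.
have E1 : x + d - e = x - e + d by ring.
pose K0 := K (x - e); pose K1 := K (x - e + d); pose K2 z := K (x - e) (z + d).
have g0 : good omega K0 by exact: gK.
have g1 : good omega K1 by rewrite /K1 -E1; exact: gK.
have g2 : good omega K2.
  have := good_shift d g0; rewrite /K2; congr (good omega _).
  by apply/funext => z; rewrite addrC.
have gN (c : R[i]) L : good omega L -> good omega (fun z => c * L z) by exact: goodZ.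
have BD L L' : good omega L -> good omega L' ->
    Bop e (fun z => L z - L' z) y = Bop e L y - Bop e L' y.
  move=> gL gL'; rewrite /Bop -mulrBr.
  rewrite -(cintegralB (cintegrable_Bop omega_gt0 e01 y gL) (cintegrable_Bop omega_gt0 e01 y gL')).
  by congr (_ * cintegral _); apply/funext => t; rewrite mulrBr.
have B2 : Bop e K0 (y + d) = Bop e K2 y.
  rewrite /Bop; congr (_ * cintegral _); apply/funext => t.
  by rewrite /K2 /K0 -addrA [d + t]addrC addrA.
have gB L L' : good omega L -> good omega L' -> good omega (fun z => L z - L' z).
  move=> gL gL'; have := goodD gL (gN (-1) L' gL'); congr (good omega _).
  by apply/funext => z; rewrite mulN1r.
have i1 := gB _ _ g1 g0; have i2 := gB _ _ g2 g0.
rewrite E1 B2 -(BD _ _ g1 g0) -(BD _ _ g2 g0).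
split.
- by apply: hM => // [|z]; [have [] := g0|have [] := bnd ax' xd' z].
- rewrite -(mulrA M C); apply: hM; [by have [] := i1|exact: mulr_ge0|].
  by move=> z; have [] := bnd ax' xd' z.
- rewrite -(mulrA M C); apply: hM; [by have [] := i2|exact: mulr_ge0|].
  by move=> z; have [] := bnd ax' xd' z.
- have -> : Bop e (fun z => K1 z - K0 z) y + 'i%C * Bop e (fun z => K2 z - K0 z) y =
      Bop e (fun z => K1 z - K0 z + 'i%C * (K2 z - K0 z)) y.
    have ii := gN 'i%C _ i2.
    have D := XopD (x := 0) (w := [:: true]) omega_gt0 e01 isT i1 ii.
    have Z := XopZ (x := 0) (w := [:: true]) omega_gt0 e01 'i%C isT i2.
    have Dy := congr1 (fun f => f y) D; have Zy := congr1 (fun f => f y) Z.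
    by rewrite /= in Dy Zy; rewrite Dy Zy.
  rewrite -(mulrA M C); apply: hM.
  + by have [] := goodD i1 (gN 'i%C _ i2).
  + by rewrite mulr_ge0 // sqr_ge0.
  + by move=> z; have [] := bnd ax' xd' z.
Qed.

Lemma hol_Gfun beta a b : a <= b -> b < 0 -> -1 < omega * a ->
  - (2 * pi * omega) <= beta <= 0 -> hol beta a b (Gfun omega).
Proof.
have o0 := omega_gt0; move=> ab b0 oa hb.
have off : off_period (- (2 * pi * omega)) a b.
  move=> x /andP[ax xb]; apply: off_period_G => //; first by lra.
  by apply: lt_le_trans oa _; rewrite ler_pM2l.
have hk : hol beta a b (kern (- (2 * pi * omega))).
  by apply: hol_kern => //; rewrite hb orbT.
by have := hol_mul (hol_cst (hbarC omega) a b) hk; rewrite add0r.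
Qed.

(** [~~ last true w] means that [w] is nonempty and ends in a. This last a provides the exponent -
    m, and the other letters a contribute exponent 0. *)
Lemma hol_Xop e w a b : 0 < e < 1 -> ~~ last true w -> a <= b -> b < 0 ->
  -1 < omega * (a - (count id w)%:R * e) ->
  hol (- m) a b (fun x => Xop omega e x w (fun _ => 1)).
Proof.
have o0 := omega_gt0; move=> e01; have /andP[e0 _] := e01.
elim: w a b => [|x w IH] a b //=.
case: w IH => [|x' w] IH.
  case: x => //= _ ab b0 oa.
  have hG : hol (- m) a b (Gfun omega).
    apply: hol_Gfun => //; first by rewrite mul0r subr0 in oa.
    by rewrite lerN2 ge_min lexx orbT /= oppr_le0 ltW // (decay_gt0 omega_gt0).
  by have := hol_mul hG (hol_cst 1 a b); rewrite addr0.
move=> lw; have {}lw : ~~ last true (x' :: w) by [].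
move: (x' :: w) IH lw => {x'}w IH lw ab b0; case: x => /= oa.
  apply: (hol_Bop (K := fun z => Xop omega e z w (fun _ => 1)) e01).
  apply: IH => //; [lra|lra|].
  apply: lt_le_trans oa _; rewrite ler_pM2l //.
  by rewrite natrD mulrDl mul1r opprD addrA.
have h0 : hol 0 a b (Gfun omega).
  apply: hol_Gfun => //.
    apply: lt_le_trans oa _; rewrite ler_pM2l // gerBl mulr_ge0 ?ler0n // ltW //.
  by rewrite lexx andbT oppr_le0 !mulr_ge0 ?pi_ge0 // ltW.
by have := hol_mul h0 (IH a b lw ab b0 oa); rewrite add0r.
Qed.

Lemma Bop_contour_shift e1 e2 x y w : 0 < e1 -> e1 <= e2 -> e2 < 1 ->
  ~~ last true w -> x <= 0 -> -1 < omega * (x - e2 - (count id w)%:R * e1) ->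
  Bop e1 (Xop omega e1 (x - e1) w (fun _ => 1)) y =
  Bop e2 (Xop omega e1 (x - e2) w (fun _ => 1)) y.
Proof.
have o0 := omega_gt0; have m0 := decay_gt0 omega_gt0; move=> e10 e12 e21 lw x0 hx.
pose F x := Xop omega e1 x w (fun _ => 1).
have hF : hol (- m) (x - e2) (x - e1) F.
  by apply: hol_Xop => //; [apply/andP; split; lra|lra|lra].
have hS := hol_translate x y hF.
rewrite (_ : x - e2 - x = - e2) in hS; last by ring.
rewrite (_ : x - e1 - x = - e1) in hS; last by ring.
have p0 := pi_gt0 R.
have off : off_period (2 * pi) (- e2) (- e1).
  move=> z /andP[z1 z2].
  have zn : z < 0 by lra.
  have z0 : 0 < - z by lra.
  have pp : 0 < 2 * pi :> R by exact: mulr_gt0.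
  rewrite normrM (gtr0_norm pp) (ltr0_norm zn); apply/andP; split; first exact: mulr_gt0.
  by rewrite -[ltRHS]mulr1 ltr_pM2l //; lra.
have mpi : m <= pi by rewrite ge_min lexx.
have e12N : - e2 <= - e1 by rewrite lerN2.
(* The kernel with exponents 0 and 2 m, times a function with exponent - m, has exponents - m and
   m. *)
have k0 : hol 0 (- e2) (- e1) (kern (2 * pi)).
  by apply: hol_kern => //; rewrite lexx mulr_ge0 // ltW.
have k1 : hol (2 * m) (- e2) (- e1) (kern (2 * pi)).
  by apply: hol_kern => //; rewrite ler_pM2l // mpi andbT mulr_ge0 // ltW.
have h0 := hol_mul k0 hS; have h1 := hol_mul k1 hS.
rewrite add0r in h0; rewrite (_ : 2 * m + - m = m) in h1; last by ring.
by rewrite /Bop (hol_integral_cst m0 e12N h0 h1).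
Qed.

(** Contours are moved one at a time from the outside. Because e1 <= e2, every mixed stage stays
    right of the line reached with e2 alone. *)
Lemma Xop_indep e1 e2 w x y : 0 < e1 -> e1 <= e2 -> e2 < 1 ->
  ~~ last true w -> x <= 0 -> (x < 0) || head true w ->
  -1 < omega * (x - (count id w)%:R * e2) ->
  Xop omega e1 x w (fun _ => 1) y = Xop omega e2 x w (fun _ => 1) y.
Proof.
have o0 := omega_gt0; move=> e10 e12 e21.
elim: w x y => [|c w IH] x y; first by [].
case: w IH => [|c' w] IH; first by case: c.
move=> lw; have {}lw : ~~ last true (c' :: w) by [].
move: (c' :: w) IH lw => {c'}w IH lw x0; case: c => /= hd oa; last first.
  by rewrite orbF in hd; congr (_ * _); apply: IH => //; rewrite hd.
have hk : -1 < omega * (x - e2 - (count id w)%:R * e2).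
  apply: lt_le_trans oa _; rewrite ler_pM2l //.
  by rewrite natrD mulrDl mul1r opprD addrA.
have hk1 : -1 < omega * (x - e2 - (count id w)%:R * e1).
  apply: lt_le_trans hk _; rewrite ler_pM2l // lerD2l lerN2.
  by rewrite ler_wpM2l.
rewrite (Bop_contour_shift y e10 e12 e21 lw x0 hk1).
suff -> : Xop omega e1 (x - e2) w (fun _ => 1) = Xop omega e2 (x - e2) w (fun _ => 1) by [].
by apply/funext => z; apply: IH lw _ _ hk; [lra|apply/orP; left; lra].
Qed.

End ContourShift.

(** * Iterated integrals and the theorem *)

Section IteratedIntegral.
Variables (R : realType) (omega e : R).
Hypotheses (omega_gt0 : 0 < omega) (e01 : 0 < e < 1).
Notation hC := (hbarC omega).
Notation Xop := (Xop omega e).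

Lemma Iomega_succ k x y : Iomega omega k.+1 (x +i* y) = Gfun omega x y ^+ k.+1.
Proof.
have hE : - hC = (- (2 * pi * omega)) *i.
  by apply/eqP; rewrite eq_complex /= !(mul0r, mulr0, subr0, addr0, add0r, oppr0) !eqxx.
by rewrite /Iomega hE.
Qed.

Lemma Xop_nseq k x w y :
  Xop x (nseq k false ++ w) (fun _ => 1) y = Gfun omega x y ^+ k * Xop x w (fun _ => 1) y.
Proof.
by elim: k => [|k IH] /=; rewrite ?expr0 ?mul1r // IH exprS mulrA.
Qed.

(** The constant 1 is not good; splitting off the last a replaces it by G, which is. *)
Lemma good_Xop_one x w : x < 0 -> ~~ last true w ->
  -1 < omega * (x - (count id w)%:R * e) -> good omega (Xop x w (fun _ => 1)).
Proof.
have o0 := omega_gt0; have /andP[e0 _] := e01; move=> x0.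
case/lastP: w => // w b; rewrite last_rcons => /negbTE ->.
rewrite -cats1 count_cat /= !addn0 cats1 Xop_rcons_a => h.
apply: good_Xop => //.
  by apply: valid_count => //; [exact: ltW|rewrite x0].
have n0 : 0 <= (count id w)%:R * e by rewrite mulr_ge0 // ltW.
have -> : (fun y => Gfun omega (x - (count id w)%:R * e) y * 1) =
    Gfun omega (x - (count id w)%:R * e) by apply/funext => y; rewrite mulr1.
by apply: good_Gfun => //; lra.
Qed.

(** The integrand left after some integrations, [S] being the sum of the variables already fixed;
    this generality makes the induction on the word possible. *)
Definition Zshift (S : R[i]) (s : seq nat) (ts : seq R[i]) : R[i] :=
  (\prod_(a < size s) (cexp (two_pi_i R * ts`_a) - 1)^-1) *
  \prod_(a < size s) Iomega omega (nth 0%N s a) (S + \sum_(b < a.+1) ts`_b).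

Lemma Zshift_cons S k s t ts : Zshift S (k :: s) (t :: ts) =
  (cexp (two_pi_i R * t) - 1)^-1 * Iomega omega k (S + t) * Zshift (S + t) s ts.
Proof.
rewrite /Zshift /= !big_ord_recl /= big_ord0 addr0 [RHS]mulrACA; congr (_ * (_ * _)).
by apply: eq_bigr => a _; rewrite big_ord_recl /= addrA.
Qed.

Lemma iterated_integral_Zshift s c x y : x <= 0 -> admissible s ->
  -1 < omega * (x - (size s)%:R * e) ->
  iterated_integral e (size s) (fun ts => c * Zshift (x +i* y) s ts) =
  c * hC ^+ count_mem 0%N s * Xop x (spell s) (fun _ => 1) y.
Proof.
have o0 := omega_gt0; have /andP[e0 _] := e01.
elim: s c x y => [|k s IH] c x y x0 ad hx.
  by rewrite /= /Zshift !big_ord0 /= expr0 !mulr1.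
have hk : -1 < omega * (x - e - (size s)%:R * e).
  apply: lt_le_trans hx _; rewrite ler_pM2l //= -natr1 mulrDl mul1r; lra.
have xe0 : x - e < 0 by lra.
have ads : admissible s by move: ad; rewrite /admissible; case: s {IH hx hk}.
set K := Xop (x - e) (nseq k false ++ spell s) (fun _ => 1).
have gK : good omega K.
  apply: good_Xop_one => //.
    rewrite last_cat; case: s ads ad {IH hx hk K} => [|k' s] ads ad.
      by case: k ad => // k _ /=; elim: k.
    have [//|u hu] := spell_admissible _ ads.
    by rewrite -[spell _]revK hu rev_cons last_rcons.
  by rewrite count_cat count_nseq mul0n count_spell.
have iK := cintegrable_Bop omega_gt0 e01 y gK.
have E t : iterated_integral e (size s) (fun ts => c * Zshift (x +i* y) (k :: s) ((- e +i* t) :: ts)) =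
    (c * hC ^+ count_mem 0%N (k :: s)) * (kern (2 * pi) (- e) t * K (y + t)).
  have -> : (fun ts => c * Zshift (x +i* y) (k :: s) ((- e +i* t) :: ts)) =
    fun ts => c * (kern (2 * pi) (- e) t * Iomega omega k ((x - e) +i* (y + t))) *
       Zshift ((x - e) +i* (y + t)) s ts.
    have hS : (x +i* y) + (- e +i* t) = (x - e) +i* (y + t) by [].
    by apply/funext => ts; rewrite Zshift_cons hS -[RHS]mulrA.
  rewrite IH //; last exact: ltW.
  rewrite /K Xop_nseq; case: k {ad hx K gK iK} => [|k].
    (* The code 0 contributes no letter a, and its constant [Iomega] supplies one more power of
       hbar. *)
    by rewrite /= expr0 add1n exprS mul1r; ring.
  by rewrite Iomega_succ /= add0n; ring.
rewrite /= /line_integral.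
under eq_fun do rewrite E.
rewrite (cintegralZ _ iK) mulrCA; congr (_ * _).
Qed.

Lemma iterated_integral_Zintegrand s : admissible s ->
  -1 < omega * (0 - (size s)%:R * e) ->
  iterated_integral e (size s) (Zintegrand omega s) =
  hC ^+ count_mem 0%N s * Xop 0 (spell s) (fun _ => 1) 0.
Proof.
move=> ad h; have := iterated_integral_Zshift 1 0 (lexx _) ad h.
rewrite mul1r => <-; congr (iterated_integral _ _ _); apply/funext => ts.
rewrite mul1r /Zshift /Zintegrand; congr (_ * _); apply: eq_bigr => a _.
by rewrite [0 +i* 0](_ : _ = 0) ?add0r.
Qed.

End IteratedIntegral.

(** * From words to the span of the admissible monomials *)

Section Main.
Variables (R : realType) (omega : R) (eps : nat -> R).
Hypotheses (omega_gt0 : 0 < omega)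
  (eps_range : forall r : nat, (0 < r)%N ->
     0 < eps r < Num.min 1 (1 / (r%:R * omega))).
Notation hC := (hbarC omega).

Let eps01 r : (0 < r)%N -> 0 < eps r < 1.
Proof.
by move=> /eps_range /andP[-> /=]; rewrite lt_min => /andP[].
Qed.

Let eps_lt r n : (0 < r)%N -> (n <= r)%N -> -1 < omega * (0 - n%:R * eps r).
Proof.
move=> r0 nr; have /andP[e0 _] := eps01 r0.
have := eps_range r0 => /andP[_]; rewrite lt_min => /andP[_].
rewrite ltr_pdivlMr ?mulr_gt0 ?ltr0n // => h.
have le : n%:R * eps r <= r%:R * eps r by rewrite ler_pM2r // ler_nat.
have := ler_wpM2l (ltW omega_gt0) le; rewrite sub0r mulrN.
have hE : eps r * (r%:R * omega) = omega * (r%:R * eps r) by ring.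
by rewrite hE in h; lra.
Qed.

(** The offset prescribed by [eps] is exchanged for any other admissible [e], so that monomials of
    different lengths can share one contour. *)
Lemma Zmonomial_Xop s e : s != [::] -> admissible s -> 0 < e < 1 ->
  -1 < omega * (0 - (size s)%:R * e) ->
  Zmonomial omega eps s =
  hC ^+ count_mem 0%N s * Xop omega e 0 (spell s) (fun _ => 1) 0.
Proof.
move=> s0 ad e01 he; have r0 : (0 < size s)%N by case: s s0 {ad he}.
have /andP[e0 e1] := e01; have /andP[er0 er1] := eps01 r0.
rewrite /Zmonomial iterated_integral_Zintegrand //; [|exact: eps01|exact: eps_lt].
congr (_ * _).
have [u hu] := spell_admissible s0 ad.
have lw : ~~ last true (spell s) by rewrite -[spell s]revK hu rev_cons last_rcons.
have hd : (0 < 0 :> R) || head true (spell s) by rewrite ltxx; case: s {s0 ad he r0 er0 er1 hu lw}.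
case: (leP e (eps (size s))) => h.
  apply/esym; apply: Xop_indep => //; rewrite count_spell; exact: eps_lt.
by apply: Xop_indep => //; [exact: ltW|rewrite count_spell].
Qed.

Lemma evalC_hbar n : evalC omega (hbar ^+ n) = hC ^+ n.
Proof. by rewrite /evalC /hbar map_polyXn hornerXn. Qed.

(* [Zomega] drops powers of hbar from the coefficients and is meaningless unless they
   are divisible; hence an element is carried along with an expansion in monomials. *)
Definition Zrel (f : frakH) (z : R[i]) : Prop :=
  exists cs : seq ({poly rat} * seq nat),
    f = \sum_(p <- cs) p.1 *: monomial p.2 /\
    z = \sum_(p <- cs) evalC omega p.1 * Zmonomial omega eps p.2.

Lemma Zrel_Zomega f z : Zrel f z -> Zomega omega eps f = z.
Proof. by move=> [cs [-> ->]]; exact: Zomega_sum. Qed.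

Lemma Zrel0 : Zrel 0 0.
Proof. by exists [::]; rewrite !big_nil. Qed.

Lemma Zrel_lin (c : {poly rat}) f z g t : Zrel f z -> Zrel g t ->
  Zrel (c *: f + g) (evalC omega c * z + t).
Proof.
move=> [cs [-> ->]] [ds [-> ->]].
exists ([seq (c * p.1, p.2) | p <- cs] ++ ds).
split.
- rewrite scaler_sumr; under eq_bigr do rewrite scalerA.
  by rewrite big_cat big_map.
- rewrite mulr_sumr big_cat big_map /=; congr (_ + _); apply: eq_bigr => p _.
  by rewrite mulrA /evalC rmorphM hornerM.
Qed.

Lemma Zrel_monomial s : Zrel (monomial s) (Zmonomial omega eps s).
Proof.
exists [:: (1, s)]; rewrite !big_seq1 scale1r; split => //.
by rewrite /evalC rmorph1 hornerC mul1r.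
Qed.

Lemma Zmonomial_nil : Zmonomial omega eps [::] = 1.
Proof. by rewrite /Zmonomial /= /Zintegrand !big_ord0 mulr1. Qed.

Lemma monomial_nil : monomial [::] = 1.
Proof. by rewrite /monomial big_nil. Qed.

Lemma Zrel_shuffle_monomial s t : admissible s -> admissible t ->
  Zrel (shuffle (monomial s) (monomial t)) (Zmonomial omega eps s * Zmonomial omega eps t).
Proof.
(* [Xop_mul] needs a last letter a in both words; an empty word is the unit on both sides. *)
move=> ads adt; have [->|s0] := eqVneq s [::].
  by rewrite monomial_nil shuffle1l Zmonomial_nil mul1r; exact: Zrel_monomial.
have [->|t0] := eqVneq t [::].
  by rewrite monomial_nil shuffle1r Zmonomial_nil mulr1; exact: Zrel_monomial.
have [u hu] := spell_admissible s0 ads; have [v hv] := spell_admissible t0 adt.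
have N0 : (0 < size s + size t)%N by case: s s0 {ads hu}.
(* This offset is admissible for both factors and for every term of their shuffle, all of which have
   [size s + size t] letters b. *)
set e := eps (size s + size t); have e01 : 0 < e < 1 by exact: eps01.
have cu : count id u = size s by rewrite -(count_spell s) -(count_rev id (spell s)) hu.
have cv : count id v = size t by rewrite -(count_spell t) -(count_rev id (spell t)) hv.
have lu : last true (false :: u) by rewrite -hu last_rev_spell.
have lv : last true (false :: v) by rewrite -hv last_rev_spell.
have hr : in_range omega e u v by rewrite /in_range cu cv; exact: eps_lt.
rewrite shuffle_monomial hu hv.
exists [seq (hbar ^+ (count_mem 0%N s + count_mem 0%N t + q.1 - zero_count q.2),
   Defs.parse (rev q.2)) | q <- shl (false :: u) (false :: v)].
rewrite !big_map; split => //.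
rewrite (@Zmonomial_Xop s e) //; last by apply: eps_lt => //; exact: leq_addr.
rewrite (@Zmonomial_Xop t e) //; last by apply: eps_lt => //; exact: leq_addl.
rewrite mulrACA -exprD -[spell s]revK -[spell t]revK hu hv Xop_mul // mulr_sumr.
apply: eq_big_seq => q qin /=; rewrite evalC_hbar.
have lq := last_shl lu lv qin; have [h1 h2 h3] := rparseP lq.
have cq := count_shl qin; rewrite /= cu cv in cq.
have hq := head_shl_aa qin.
have sp : spell (Defs.parse (rev q.2)) = rev q.2 by rewrite parse_rev.
have sz : size (Defs.parse (rev q.2)) = (size s + size t)%N.
  by rewrite -count_spell sp count_rev.
rewrite (@Zmonomial_Xop _ e) ?sz //; last exact: eps_lt.
- rewrite sp mulrA -exprD parse_rev count_rev h2 mulrA -exprD; congr (hC ^+ _ * _).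
  have [+ _] := shl_counts qin; rewrite -hu -hv !zero_count_spell => le.
  by rewrite subnK.
- by rewrite -size_eq0 sz -lt0n.
(* Every term ends in a, so its last code is at least 1. *)
- rewrite parse_rev /admissible; case: (rparse q.2) h3 => // k r; rewrite rev_cons last_rcons /=.
  by case: (q.2) hq => // b w /= -> /esym/negbT.
Qed.

Lemma Zrel_shuffle cs ds :
  all (fun p : {poly rat} * seq nat => admissible p.2) cs ->
  all (fun p : {poly rat} * seq nat => admissible p.2) ds ->
  Zrel (shuffle (\sum_(p <- cs) p.1 *: monomial p.2) (\sum_(p <- ds) p.1 *: monomial p.2))
   ((\sum_(p <- cs) evalC omega p.1 * Zmonomial omega eps p.2) *
    (\sum_(p <- ds) evalC omega p.1 * Zmonomial omega eps p.2)).
Proof.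
move=> acs ads; elim: cs acs => [_|[c s] cs IH /= /andP[as_ acs]].
  by rewrite !big_nil shuffle0l mul0r; exact: Zrel0.
rewrite !big_cons shuffle_linearl mulrDl /= -mulrA.
apply: Zrel_lin; last exact: IH.
elim: ds ads {IH} => [_|[c' t] ds IH /= /andP[at_ ads]].
  by rewrite !big_nil shuffle0r mulr0; exact: Zrel0.
rewrite !big_cons shuffle_linearr mulrDr /= mulrCA.
by apply: Zrel_lin; [exact: Zrel_shuffle_monomial|exact: IH].
Qed.

End Main.

Theorem theorem4p2 (R : realType) (omega : R) (eps : nat -> R) (w w' : frakH)
  (omega_gt0 : 0 < omega) (omega_lt2 : omega < 2)
  (eps_range : forall r : nat, (0 < r)%N ->
     0 < eps r < Num.min 1 (1 / (r%:R * omega)))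
  (hw : H0hat w) (hw' : H0hat w') :
  Zomega omega eps (shuffle w w') = Zomega omega eps w * Zomega omega eps w'.
Proof.
have [cs [acs ->]] := hw; have [ds [ads ->]] := hw'; rewrite !Zomega_sum.
exact: (Zrel_Zomega (Zrel_shuffle omega_gt0 eps_range acs ads)).
Qed.
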